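(* In the normal-cell setting described in the context, fix one piece of codimension $d\ge1$ and suppress its index. Suppose that its admissible cells are cones, $\mathsf A(p)=C(p)\subset\mathbb R^d$, and that $a$ is bounded on its truncated tube $F(\mathfrak D(\varepsilon))$. Suppose that, uniformly in $p\in P$ and for $s\in C(p)$ near zero, $$f(F(p,s))-f_0=\tfrac12\langle H(p)s,s\rangle+O(|s|^3),\qquad a(F(p,s))J(p,s)=a(p)+O(|s|),$$ where the symmetric $d\times d$ matrices $H(p)$ (measurable in $p$) satisfy, for some constants $0<\lambda_-\le\lambda_+<\infty$, $\lambda_-|t|^2\le\langle H(p)t,t\rangle\le\lambda_+|t|^2$ for all $t\in\mathbb R^d$, $p\in P$. Then, provided the tube radius $\varepsilon$ is sufficiently small, as $z\to\infty$, uniformly in $p\in P$, $$\mathcal I(z,p)=e^{-zf_0}z^{-d/2}\left[a(p)\int_{C(p)}e^{-\langle H(p)t,t\rangle/2}\,dt+O(z^{-1/2})\right].$$ If $Y_p$ is a centered Gaussian vector with covariance $H(p)^{-1}$, then $$\int_{C(p)}e^{-\langle H(p)t,t\rangle/2}\,dt=\frac{(2\pi)^{d/2}}{\sqrt{\det H(p)}}\,\mathbb P\{Y_p\in C(p)\}.$$ (For $C(p)=\mathbb R^d$ the probability is $1$; for a half-space through the origin it is $1/2$.)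
   Context: Setting. $(N,g)$ is a $C^2$ Riemannian manifold of dimension $n$ with Riemannian volume measure $\mathrm{dvol}_g$; $f:N\to\mathbb R$ is continuous and bounded below; $a:N\to\mathbb C$ is measurable; $f_0:=\inf_Nf$; $M:=\{x\in N:f(x)=f_0\}$ is nonempty and compact. $\mathcal T_\varepsilon(M):=\{x:\operatorname{dist}_g(x,M)<\varepsilon\}$; $B_r$ is the open Euclidean ball of radius $r$ at $0$. $M=\bigsqcup_{j=0}^{\ell}\Sigma_j$ is a disjoint union of finitely many $C^2$ embedded strata, $\Sigma_j$ a (possibly empty or disconnected) $j$-dimensional submanifold. Normal-cell decomposition. There are $\varepsilon>0$ and a finite index set $\mathcal A$, and for each $\alpha\in\mathcal A$: a Borel set $P_\alpha\subset\Sigma_{j_\alpha}$ of finite $j_\alpha$-dimensional Riemannian volume, with $M=\bigsqcup_\alpha P_\alpha$; an open neighborhood $U_\alpha$ of $P_\alpha$ in $\Sigma_{j_\alpha}$; the codimension $d_\alpha:=n-j_\alpha$; a $C^1$ map $F_\alpha:U_\alpha\times B_\varepsilon\to N$ with $F_\alpha(p,0)=p$; and sets (cells) $\mathsf A_\alpha(p)\subset\mathbb R^{d_\alpha}$, $p\in P_\alpha$, with measurable graph. With $\mathfrak D_\alpha(\varepsilon):=\{(p,s):p\in P_\alpha,\ s\in\mathsf A_\alpha(p)\cap B_\varepsilon\}$, the sets $F_\alpha(\mathfrak D_\alpha(\varepsilon))$ are pairwise disjoint up to null sets and cover $\mathcal T_\varepsilon(M)$ up to a null set, and there are measurable $J_\alpha:\mathfrak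 D_\alpha(\varepsilon)\to(0,\infty)$ such that for every nonnegative measurable $h$ $$\int_{F_\alpha(\mathfrak D_\alpha(\varepsilon))}h\,\mathrm{dvol}_g=\int_{P_\alpha}\int_{\mathsf A_\alpha(p)\cap B_\varepsilon}h(F_\alpha(p,s))J_\alpha(p,s)\,ds\,\mathrm{dvol}_{P_\alpha}(p).$$ For $z>0$ put $\mathcal I_\alpha(z,p):=\int_{\mathsf A_\alpha(p)\cap B_\varepsilon}a(F_\alpha(p,s))J_\alpha(p,s)e^{-zf(F_\alpha(p,s))}\,ds$. A cone is a set containing $0$ and invariant under multiplication by positive scalars. *)

(* Defs.v *)
From HB Require Import structures.
From mathcomp Require Import all_boot all_order all_algebra.
From mathcomp Require Import all_classical all_reals all_analysis.
From mathcomp Require Import measurable_realfun complex.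

Set Implicit Arguments.
Unset Strict Implicit.
Unset Printing Implicit Defensive.

Import Order.TTheory GRing.Theory Num.Theory.
Import numFieldNormedType.Exports.

Local Open Scope classical_set_scope.
Local Open Scope ring_scope.

(* Vectors of R^n are row vectors 'rV[R]_n; the topology of 'rV[R]_n is the   *)
(* usual one, but the library norm is the sup norm, so the Euclidean norm is  *)
(* introduced below as enorm.                                                 *)

Section matrix_borel.
Variables (R : realType) (m n : nat).

Let mx_measurable : set (set 'M[R]_(m, n)) := <<s @open 'M[R]_(m, n) >>.
Let mx_measurable0 : mx_measurable set0.
Proof. exact: sigma_algebra0. Qed.
Let mx_measurableC A : mx_measurable A -> mx_measurable (~` A).
Proof. exact: sigma_algebraC. Qed.
Let mx_measurableU (F : (set 'M[R]_(m, n))^nat) :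
  (forall i, mx_measurable (F i)) -> mx_measurable (\bigcup_i F i).
Proof. exact: sigma_algebra_bigcup. Qed.

HB.instance Definition _ :=
  @isMeasurable.Build (sigma_display (@open 'M[R]_(m, n))) 'M[R]_(m, n)
    mx_measurable mx_measurable0 mx_measurableC mx_measurableU.

Lemma mx_measurableE :
  @measurable _ 'M[R]_(m, n) = <<s @open 'M[R]_(m, n) >>.
Proof. by []. Qed.

Lemma open_measurable_mx (A : set 'M[R]_(m, n)) : open A -> measurable A.
Proof. exact: sub_sigma_algebra. Qed.

Lemma measurable_fun_mx d (T : measurableType d) (f : T -> 'M[R]_(m, n)) :
  (forall A, open A -> measurable (f @^-1` A)) -> measurable_fun setT f.
Proof.
move=> H; apply: (@measurability _ _ _ _ setT f (@open 'M[R]_(m, n))) => //.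
by move=> _ [B oB <-]; rewrite setTI; exact: H.
Qed.

Lemma open_mx_bigcup (A : set 'M[R]_(m, n)) : open A ->
  A = \bigcup_(q in [set q : 'M[rat]_(m, n) * nat |
        ball (map_mx ratr q.1 : 'M[R]_(m, n)) q.2.+1%:R^-1 `<=` A])
      ball (map_mx ratr q.1 : 'M[R]_(m, n)) q.2.+1%:R^-1.
Proof.
move=> oA; apply/seteqP; split => [x Ax|x [q /= qA xq]]; last exact: qA.
have /nbhs_ballP[e /= e0 xeA] : nbhs x A by exact: open_nbhs_nbhs.
have [k ke] : exists k : nat, k.+1%:R^-1 < e / 2 :> R.
  have /ltr_add_invr[k] : (0 : R) < e / 2 by rewrite divr_gt0.
  by rewrite add0r => ?; exists k.
have k0 : 0 < k.+1%:R^-1 :> R by rewrite invr_gt0.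
have ex i j : exists q : rat, `|ratr q - x i j| < k.+1%:R^-1 :> R.
  have /rat_in_itvoo[q] : x i j < x i j + k.+1%:R^-1 by rewrite ltrDl.
  rewrite in_itv/= => /andP[q1 q2]; exists q.
  by rewrite gtr0_norm ?subr_gt0// ltrBlDl.
have /choice[f fP] : forall ij : 'I_m * 'I_n, exists q : rat,
    `|ratr q - x ij.1 ij.2| < k.+1%:R^-1 :> R by move=> [i j]; exact: ex.
exists (\matrix_(i, j) f (i, j), k) => /=; last first.
  by split => // i j; rewrite !mxE /ball/=; exact: (fP (i, j)).
move=> y [_ xy]; apply: xeA; split => // i j.
have := xy i j; rewrite !mxE /ball/= => h.
have -> : x i j - y i j = - (ratr (f (i, j)) - x i j) + (ratr (f (i, j)) - y i j).
  by rewrite opprB addrA subrK.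
rewrite (le_lt_trans (ler_normD _ _))// normrN (splitr e) ltrD//.
  by rewrite (lt_trans (fP (i, j))).
by rewrite (lt_trans h).
Qed.

End matrix_borel.

Section continuous.
Variables (R : realType).

Lemma continuous_measurable_mx m n p q (f : 'M[R]_(m, n) -> 'M[R]_(p, q)) :
  continuous f -> measurable_fun setT f.
Proof.
move=> cf; apply: measurable_fun_mx => A oA; apply: open_measurable_mx.
by apply: open_comp => // x _; exact: cf.
Qed.

Lemma measurable_coord m n i j :
  measurable_fun setT (fun M : 'M[R]_(m, n) => M i j).
Proof.
apply: (measurability _ (RGenOpens.measurableE R)) => _ [_ [a [b ->]] <-].
rewrite setTI; apply: open_measurable_mx.
by apply: open_comp => // x _; exact: coord_continuous.
Qed.

Definition rV_cons n (p : R * 'rV[R]_n) : 'rV[R]_n.+1 := row_mx p.1%:M p.2.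
Definition rV_uncons n (v : 'rV[R]_n.+1) : R * 'rV[R]_n :=
  (v 0 0, rsubmx (v : 'rV_(1 + n))).

Lemma rV_cons0 n p : @rV_cons n p 0 0 = p.1.
Proof.
have <- : (p.1%:M : 'M[R]_1) 0 0 = p.1 by rewrite mxE eqxx mulr1n.
rewrite -(@row_mxEl _ 1 1 n p.1%:M p.2 0 0).
by congr (row_mx _ _ _ _); exact/val_inj.
Qed.

Lemma rV_consS n p i : @rV_cons n p 0 (lift 0 i) = p.2 0 i.
Proof.
have <- := @row_mxEr _ 1 1 n p.1%:M p.2 0 i.
by congr (row_mx _ _ _ _); exact/val_inj.
Qed.

Lemma rV_consK n : cancel (@rV_cons n) (@rV_uncons n).
Proof. by move=> [x v]; rewrite /rV_uncons rV_cons0 /rV_cons row_mxKr. Qed.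

Lemma rV_unconsK n : cancel (@rV_uncons n) (@rV_cons n).
Proof.
move=> v; apply/rowP => i; case: (unliftP 0 i) => [j ->|->].
  rewrite rV_consS mxE; congr (v _ _).
  by apply/val_inj.
by rewrite rV_cons0.
Qed.

Lemma measurable_rV_uncons n : measurable_fun setT (@rV_uncons n).
Proof.
apply/measurable_fun_pairP; split; first exact: measurable_coord.
apply: continuous_measurable_mx => v A /nbhs_ballP[e e0 eA].
by apply/nbhs_ballP; exists e => // w [_ vw]; apply: eA; split => // i j;
  rewrite !mxE; exact: vw.
Qed.

Lemma measurable_rV_cons n : measurable_fun setT (@rV_cons n).
Proof.
apply: measurable_fun_mx => A /open_mx_bigcup ->.
rewrite preimage_bigcup bigcup_mkcond.
apply: countable_bigcupT_measurable => // q; case: ifPn => // _.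
set c := map_mx _ _; set e := _^-1.
have -> : @rV_cons n @^-1` ball c e =
    ball (@rV_uncons n c).1 e `*` ball (@rV_uncons n c).2 e.
  apply/seteqP; split => -[x v] /=.
    move=> [e0 cxv]; split => /=.
      by have := cxv 0 0; rewrite rV_cons0.
    split => // i j; rewrite ord1 [rsubmx _ _ _]mxE.
    rewrite (_ : rshift 1 j = lift 0 j); last exact/val_inj.
    by have := cxv 0 (lift 0 j); rewrite rV_consS.
  move=> [/= cx [e0 cv]]; split => // i j; rewrite ord1.
  case: (unliftP 0 j) => [k ->|->]; last by rewrite rV_cons0.
  have := cv 0 k; rewrite [rsubmx _ _ _]mxE rV_consS.
  by rewrite (_ : rshift 1 k = lift 0 k); last exact/val_inj.
apply: measurableX; first by apply: open_measurable; exact: ball_open.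
by apply: open_measurable_mx; exact: ball_open.
Qed.

HB.instance Definition _ n :=
  @isMeasurableFun.Build _ _ _ _ (@rV_cons n) (@measurable_rV_cons n).

Definition rV_box n (A : 'I_n -> set R) : set 'rV[R]_n :=
  [set v | forall i, A i (v 0 i)].

Lemma measurable_rV_box n (A : 'I_n -> set R) :
  (forall i, measurable (A i)) -> measurable (rV_box A).
Proof.
move=> mA; have -> : rV_box A =
    \bigcap_(i in [set: 'I_n]) ((fun v : 'rV[R]_n => v 0 i) @^-1` A i).
  by apply/seteqP; split => v /= h i; [move=> _|]; exact: h.
apply: fin_bigcap_measurable => // i _; rewrite -[X in measurable X]setTI.
exact: measurable_coord.
Qed.

End continuous.

Section lebesgue_rV.
Variable R : realType.
Local Open Scope ereal_scope.

(* Lebesgue measure on R^n as an iterated product measure; lebesgue_rV_box    *)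
(* gives its value on products of measurable sets.                            *)
Fixpoint lebesgue_rV n : set 'rV[R]_n -> \bar R :=
  if n is k.+1 then
    fun A => \int[lebesgue_measure]_x lebesgue_rV [set v | A (rV_cons (x, v))]
  else fun A => \d_(0%R : 'rV[R]_0) A.

Let step n (m : {sigma_finite_measure set 'rV[R]_n -> \bar R})
    (A : set 'rV[R]_n.+1) : \bar R :=
  (lebesgue_measure \x m) (@rV_cons R n @^-1` A).

Let step0 n m : @step n m set0 = 0.
Proof. by rewrite /step preimage_set0 measure0. Qed.
Let step_ge0 n m A : 0 <= @step n m A.
Proof. exact: (measure_ge0 (lebesgue_measure \x m)). Qed.
Let step_additive n m : semi_sigma_additive (@step n m).
Proof.
have mc A : measurable A -> measurable (@rV_cons R n @^-1` A).
  by move=> mA; rewrite -[X in measurable X]setTI; exact: measurable_rV_cons.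
move=> F mF tF mUF; rewrite /step preimage_bigcup.
apply: measure_semi_sigma_additive.
- by move=> k; exact: mc.
- apply/trivIsetP => /= i j _ _ ij; rewrite -preimage_setI.
  by move/trivIsetP : tF => /(_ _ _ _ _ ij) ->//; rewrite preimage_set0.
- by rewrite -preimage_bigcup; exact: mc.
Qed.

Let spec n (m : set 'rV[R]_n -> \bar R) :=
  forall A, (forall i, measurable (A i)) ->
    m (rV_box A) = \prod_(i < n) lebesgue_measure (A i).

Let step_spec n (m : {sigma_finite_measure set 'rV[R]_n -> \bar R}) :
  spec m -> spec (step m).
Proof.
move=> mE A mA; rewrite big_ord_recl -mE//.
rewrite -(@product_measure1E _ _ _ _ R (@lebesgue_measure R) m); [|exact: mA|
  by apply: measurable_rV_box => i; exact: mA].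
congr (product_measure1 _ _ _).
apply/seteqP; split => -[x v] /=.
  move=> h; split => [|i] /=; first by have := h 0%R; rewrite rV_cons0.
  by have := h (lift 0%R i); rewrite rV_consS.
move=> [/= Ax Av] i; case: (unliftP 0%R i) => [j ->|->].
  by rewrite rV_consS; exact: Av.
by rewrite rV_cons0.
Qed.

Let spec_sigma_finite n (m : set 'rV[R]_n -> \bar R) :
  spec m -> sigma_finite setT m.
Proof.
move=> mE; exists (fun k => rV_box (fun=> `](- k%:R)%R, k%:R%R[%classic)).
  apply/esym; rewrite -subTset => v _.
  have [k] : exists k : nat, (`|v| < k%:R)%R.
    by exists (Num.bound `|v|); rewrite (le_lt_trans _ (archi_boundP _)).
  move=> vk; exists k => // i; rewrite /= in_itv/= -ltr_norml.
  rewrite (le_lt_trans _ vk)// [leRHS]/Num.Def.normr/= mx_normrE.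
  by rewrite (bigmax_sup (0%R, i)).
move=> k; split; first by apply: measurable_rV_box.
rewrite mE// (_ : \prod_(i < n) _ = ((k%:R + k%:R) ^+ n)%:E) ?ltry//.
under eq_bigr do rewrite lebesgue_measure_itv/=.
rewrite opprK (_ : (if _ then _ else _) = ((k%:R + k%:R : R)%R)%:E); last first.
  case: ifPn => //; rewrite lte_fin -leNgt => k0.
  have -> : k%:R = 0%R :> R.
    apply/eqP; rewrite eq_le ler0n andbT (le_trans k0)// oppr_le0.
  by rewrite addr0.
by rewrite prodEFin prodr_const card_ord.
Qed.

Let lebesgue_rV_ex n :
  exists2 m : {sigma_finite_measure set 'rV[R]_n -> \bar R},
    lebesgue_rV (n := n) = m :> (set _ -> \bar R) & spec m.
Proof.
elim: n => [|n [m mE ms]].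
  exists [the {sigma_finite_measure set 'rV[R]_0 -> \bar R} of \d_(0%R : 'rV[R]_0)].
    by [].
  by move=> A mA; rewrite big_ord0 /= diracE mem_set//= => i; case: i.
have ss := step_spec ms.
pose s0 := isMeasure.Build _ _ R (step m)
  (step0 m) (step_ge0 m) (@step_additive _ m).
pose M0 : {measure set 'rV[R]_n.+1 -> \bar R} := HB.pack (step m) s0.
pose s1 := Measure_isSigmaFinite.Build _ _ R M0 (spec_sigma_finite ss).
pose M : {sigma_finite_measure set 'rV[R]_n.+1 -> \bar R} :=
  HB.pack (Measure.sort M0) s1.
exists M => //.
apply/funext => A; rewrite /= /step /product_measure1 /=.
apply: eq_integral => x _; rewrite mE /=; congr (m _).
by apply/seteqP; split => v; rewrite /xsection /= inE.
Qed.

Let lebesgue_rV0 n : @lebesgue_rV n set0 = 0.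
Proof. by have [m -> _] := lebesgue_rV_ex n; exact: measure0. Qed.
Let lebesgue_rV_ge0 n A : 0 <= @lebesgue_rV n A.
Proof. by have [m -> _] := lebesgue_rV_ex n; exact: measure_ge0. Qed.
Let lebesgue_rV_additive n : semi_sigma_additive (@lebesgue_rV n).
Proof.
by have [m -> _] := lebesgue_rV_ex n; exact: measure_semi_sigma_additive.
Qed.

HB.instance Definition _ n := isMeasure.Build _ _ _ (@lebesgue_rV n)
  (@lebesgue_rV0 n) (@lebesgue_rV_ge0 n) (@lebesgue_rV_additive n).

Lemma lebesgue_rV_box n (A : 'I_n -> set R) : (forall i, measurable (A i)) ->
  lebesgue_rV (rV_box A) = \prod_(i < n) lebesgue_measure (A i).
Proof. by have [m -> ms] := lebesgue_rV_ex n; exact: ms. Qed.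

HB.instance Definition _ n := Measure_isSigmaFinite.Build _ _ _ (@lebesgue_rV n)
  (spec_sigma_finite (@lebesgue_rV_box n)).

End lebesgue_rV.

Notation borel T := (g_sigma_algebraType (@open T)).

Section euclidean.
Variables (R : realType) (n : nat).

Definition dotv (u v : 'rV[R]_n) : R := \sum_(i < n) u 0 i * v 0 i.

Definition enorm (v : 'rV[R]_n) : R := Num.sqrt (dotv v v).

Definition eball (r : R) : set 'rV[R]_n := [set v | enorm v < r].

(* <H t, t>; in row vector notation H t is t *m H^T, and H is symmetric
   wherever qform is used. *)
Definition qform (H : 'M[R]_n) (t : 'rV[R]_n) : R := dotv (t *m H) t.

Definition is_cone (C : set 'rV[R]_n) :=
  C 0 /\ forall (c : R) v, 0 < c -> C v -> C (c *: v).

End euclidean.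

(* f is of class C^k at the points of D, which is meant to be open. For a
   finite-dimensional V, continuity of x |-> 'd f x is equivalent to continuity
   of x |-> 'd f x v for every v. *)
Fixpoint Ck (R : realType) (V W : normedModType R) (k : nat) (D : set V)
    (f : V -> W) : Prop :=
  if k is k'.+1 then
    (forall x, D x -> differentiable f x) /\
    (forall v, Ck k' D (fun x => 'd f x v))
  else forall x, D x -> {for x, continuous f}.

(* An n-dimensional Riemannian manifold of class C^2: a Hausdorff second
   countable space with an atlas of class C^2 and a Riemannian metric of class
   C^1, which is the regularity of a metric that is meaningful for such an
   atlas. [metric i y] is the Gram matrix of the metric at the point of
   coordinates y in the chart i. *)
Record riemannian (R : realType) (n : nat) (N : ptopologicalType) :=
    Riemannian {
  chart_ix : Type ;
  chart_dom : chart_ix -> set N ;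
  chart : chart_ix -> N -> 'rV[R]_n ;
  chart_inv : chart_ix -> 'rV[R]_n -> N ;
  chart_at : N -> chart_ix ;
  metric : chart_ix -> 'rV[R]_n -> 'M[R]_n ;
  rm_hausdorff : hausdorff_space N ;
  rm_second_countable : @second_countable N ;
  chart_dom_open : forall i, open (chart_dom i) ;
  chart_img_open : forall i, open (chart i @` chart_dom i) ;
  chart_continuous : forall i x, chart_dom i x -> {for x, continuous (chart i)} ;
  chart_inv_continuous : forall i y, (chart i @` chart_dom i) y ->
    {for y, continuous (chart_inv i)} ;
  chartK : forall i x, chart_dom i x -> chart_inv i (chart i x) = x ;
  chart_at_dom : forall x, chart_dom (chart_at x) x ;
  chart_change : forall i j,
    Ck 2 (chart i @` (chart_dom i `&` chart_dom j)) (chart j \o chart_inv i) ;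
  metric_C1 : forall i, Ck 1 (chart i @` chart_dom i) (metric i) ;
  metric_sym : forall i x, chart_dom i x ->
    (metric i (chart i x))^T = metric i (chart i x) ;
  metric_gt0 : forall i x (v : 'rV[R]_n), chart_dom i x -> v != 0 ->
    0 < qform (metric i (chart i x)) v ;
  metric_change : forall i j x, chart_dom i x -> chart_dom j x ->
    let J := 'J (chart j \o chart_inv i) (chart i x) in
    metric i (chart i x) = J *m metric j (chart j x) *m J^T
}.

Arguments chart_dom {R n N} g i : rename.
Arguments chart {R n N} g i : rename.
Arguments chart_inv {R n N} g i : rename.
Arguments chart_at {R n N} g x : rename.
Arguments metric {R n N} g i y : rename.

Section riemannian_geometry.
Variables (R : realType) (n : nat) (N : ptopologicalType).
Variable g : riemannian R n N.

Definition CkM (V : normedModType R) (k : nat) (D : set V) (h : V -> N) :=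
  (forall x, D x -> {for x, continuous h}) /\
  (forall i, Ck k (D `&` h @^-1` chart_dom g i) (chart g i \o h)).

Definition C1_curve (c : R -> N) :=
  exists U : set R, [/\ open U, `[0, 1] `<=` U & CkM 1 U c].

Definition speed (c : R -> N) (t : R) : R :=
  let i := chart_at g (c t) in
  Num.sqrt (qform (metric g i (chart g i (c t))) (derive1 (chart g i \o c) t)).

Definition curve_length (c : R -> N) : \bar R :=
  (\int[lebesgue_measure]_(t in `[0%R, 1%R]) (speed c t)%:E)%E.

(* s is a piecewise C^1 path from x to y, given by its C^1 pieces. *)
Fixpoint piecewise_C1 (x y : N) (s : seq (R -> N)) : Prop :=
  if s is c :: s' then [/\ C1_curve c, c 0 = x & piecewise_C1 (c 1) y s']
  else x = y.

(* +oo if x and y lie in different connected components. *)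
Definition riem_dist (x y : N) : \bar R :=
  ereal_inf [set (\sum_(c <- s) curve_length c)%E | s in piecewise_C1 x y].

Definition riem_dist_set (x : N) (A : set N) : \bar R :=
  ereal_inf [set riem_dist x y | y in A].

Definition tubular_nbhs (A : set N) (r : R) : set N :=
  [set x | (riem_dist_set x A < r%:E)%E].

(* psi : V -> S is a regular C^2 parametrization of a relatively open part of
   S: an immersion that is a homeomorphism onto its image. *)
Definition local_param (j : nat) (S : set N) (V : set 'rV[R]_j)
    (psi : 'rV[R]_j -> N) :=
  [/\ open V, CkM 2 V psi,
      forall u, V u -> row_free ('J (chart g (chart_at g (psi u)) \o psi) u),
      set_inj V psi &
      forall V', open V' -> V' `<=` V ->
        exists2 W : set N, open W & psi @` V' = W `&` S].

(* S is a C^2 embedded submanifold of dimension j. *)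
Definition embedded_submanifold (j : nat) (S : set N) :=
  forall x, S x -> exists (V : set 'rV[R]_j) psi, local_param S V psi /\ (psi @` V) x.

(* Density of the j-dimensional Riemannian volume in a parametrization. *)
Definition gram_density (j : nat) (psi : 'rV[R]_j -> N) (u : 'rV[R]_j) : R :=
  let i := chart_at g (psi u) in
  let J := 'J (chart g i \o psi) u in
  Num.sqrt (\det (J *m metric g i (chart g i (psi u)) *m J^T)).

(* mu is the j-dimensional Riemannian volume of the submanifold S, seen as a
   Borel measure on N that does not charge the complement of S. For S = setT
   and j = n this is the Riemannian volume of N. *)
Definition riem_volume (j : nat) (S : set N)
    (mu : {measure set (borel N) -> \bar R}) :=
  (forall B : set (borel N), measurable B -> B `&` S = set0 -> mu B = 0%E) /\
  (forall (V : set 'rV[R]_j) psi, local_param S V psi ->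
    forall B : set (borel N), measurable B -> B `<=` psi @` V ->
      mu B = \int[@lebesgue_rV R j]_(u in V `&` psi @^-1` B)
               (gram_density psi u)%:E)%E.

End riemannian_geometry.

Section normal_cells.
Variables (R : realType) (n : nat) (N : ptopologicalType).
Variables (g : riemannian R n N) (vol : {measure set (borel N) -> \bar R}).
Variables (M : set N) (eps : R).

Definition cell_domain d (P : set N) (A : N -> set 'rV[R]_d) (r : R) :
    set (borel N * 'rV[R]_d) :=
  [set x | P x.1 /\ (A x.1 `&` eball r) x.2].

Definition cell_tube d (P : set N) (A : N -> set 'rV[R]_d)
    (F : N -> 'rV[R]_d -> N) (r : R) : set N :=
  [set F x.1 x.2 | x in cell_domain P A r].

Unset Implicit Arguments.

(* A stratification of M together with its normal-cell decomposition. F, cell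
   and jac are total functions, constrained on their actual domains only. In
   jac_change the image of the cell domain, a continuous image of a Borel set,
   need not be Borel; the integral of a nonnegative function over it is then
   the supremum of the integrals of the simple functions below, which agrees
   with the integral for the completed measure. *)
Record normal_cells := NormalCells {
  top_dim : nat ;
  top_dim_le : (top_dim <= n)%N ;
  stratum : 'I_top_dim.+1 -> set N ;
  stratum_submanifold : forall j : 'I_top_dim.+1,
    embedded_submanifold g j (stratum j) ;
  stratum_disjoint : trivIset setT stratum ;
  stratum_cover : \bigcup_j stratum j = M ;
  stratum_vol : 'I_top_dim.+1 -> {measure set (borel N) -> \bar R} ;
  stratum_volP : forall j : 'I_top_dim.+1,
    riem_volume g j (stratum j) (stratum_vol j) ;
  radius_gt0 : 0 < eps ;
  piece_ix : finType ;
  piece_dim : piece_ix -> 'I_top_dim.+1 ;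
  codim := (fun k => n - piece_dim k)%N ;
  piece : piece_ix -> set N ;
  piece_stratum : forall k, piece k `<=` stratum (piece_dim k) ;
  piece_borel : forall k, measurable (piece k : set (borel N)) ;
  piece_vol_fin : forall k, (stratum_vol (piece_dim k) (piece k) < +oo)%E ;
  piece_disjoint : trivIset setT piece ;
  piece_cover : \bigcup_k piece k = M ;
  piece_nbhs : piece_ix -> set N ;
  piece_nbhs_open : forall k, exists2 W : set N, open W &
    piece_nbhs k = W `&` stratum (piece_dim k) ;
  piece_sub_nbhs : forall k, piece k `<=` piece_nbhs k ;
  F : forall k, N -> 'rV[R]_(codim k) -> N ;
  F_C1 : forall k (V : set 'rV[R]_(piece_dim k)) psi,
    local_param g (stratum (piece_dim k)) V psi ->
    CkM g 1
      [set w : 'rV[R]_(piece_dim k) * 'rV[R]_(codim k) |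
        [/\ V w.1, piece_nbhs k (psi w.1) & eball eps w.2]]
      (fun w => F k (psi w.1) w.2) ;
  F0 : forall k p, piece_nbhs k p -> F k p 0 = p ;
  cell : forall k, N -> set 'rV[R]_(codim k) ;
  cell_graph : forall k, measurable
    [set x : borel N * 'rV[R]_(codim k) | piece k x.1 /\ cell k x.1 x.2] ;
  tube_disjoint : forall k l, k != l ->
    vol.-negligible (cell_tube (piece k) (cell k) (F k) eps `&`
                     cell_tube (piece l) (cell l) (F l) eps) ;
  tube_cover :
    vol.-negligible (tubular_nbhs g M eps `\`
      \bigcup_k cell_tube (piece k) (cell k) (F k) eps) ;
  jac : forall k, N -> 'rV[R]_(codim k) -> R ;
  jac_gt0 : forall k p s, piece k p -> (cell k p `&` eball eps) s ->
    0 < jac k p s ;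
  jac_measurable : forall k, measurable_fun
    (cell_domain (piece k) (cell k) eps) (fun x => jac k x.1 x.2) ;
  jac_change : forall k (h : borel N -> \bar R),
    measurable_fun setT h -> (forall x, 0 <= h x)%E ->
    (\int[vol]_(x in cell_tube (piece k) (cell k) (F k) eps) h x =
     \int[stratum_vol (piece_dim k)]_(p in piece k)
       \int[@lebesgue_rV R (codim k)]_(s in cell k p `&` eball eps)
         (h (F k p s) * (jac k p s)%:E))%E
}.

Set Implicit Arguments.

End normal_cells.

Arguments normal_cells {R n N} g vol M eps.
Arguments piece_ix {R n N g vol M eps} S : rename.
Arguments codim {R n N g vol M eps} S k : rename.
Arguments piece {R n N g vol M eps} S k : rename.
Arguments F {R n N g vol M eps} S k p s : rename.
Arguments cell {R n N g vol M eps} S k p : rename.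
Arguments jac {R n N g vol M eps} S k p s : rename.

Section complex_integral.
Context d (T : measurableType d) (R : realType).

Definition cmeasurable_fun (D : set T) (h : T -> R[i]) :=
  measurable_fun D (fun x => complex.Re (h x)) /\
  measurable_fun D (fun x => complex.Im (h x)).

Variable mu : {measure set T -> \bar R}.

Definition cintegrable (D : set T) (h : T -> R[i]) :=
  mu.-integrable D (fun x => (complex.Re (h x))%:E) /\
  mu.-integrable D (fun x => (complex.Im (h x))%:E).

Definition cintegral (D : set T) (h : T -> R[i]) : R[i] :=
  (\int[mu]_(x in D) complex.Re (h x) +i*
   \int[mu]_(x in D) complex.Im (h x))%C.

End complex_integral.

Definition cabs (R : realType) (x : R[i]) : R := ComplexField.Normc.normc x.

(* E(p, s) = O(|s|^k) uniformly in p in P, for s in C(p) near 0; E(p, s) is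
   only considered for |s| < r. *)
Definition unif_bigO (R : realType) (T : Type) d (P : set T)
    (C : T -> set 'rV[R]_d) (r : R) (E : T -> 'rV[R]_d -> R) (k : nat) :=
  exists K delta : R, 0 < delta /\
    forall p s, P p -> C p s -> enorm s < r -> enorm s < delta ->
      `|E p s| <= K * enorm s ^+ k.

Section laplace.
Variables (R : realType) (n : nat) (N : ptopologicalType).

Definition inf_value (f : N -> R) : R := inf (range f).

Definition argmin (f : N -> R) : set N := [set x | f x = inf_value f].

Definition laplace_integrand d (f : N -> R) (a : N -> R[i])
    (Phi : N -> 'rV[R]_d -> N) (J : N -> 'rV[R]_d -> R) (z : R) (p : N)
    (s : 'rV[R]_d) : R[i] :=
  a (Phi p s) * (J p s * expR (- (z * f (Phi p s))))%:C%C.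

Definition gauss_integral_on d (H : 'M[R]_d) (C : set 'rV[R]_d) : R :=
  \int[@lebesgue_rV R d]_(t in C) expR (- (qform H t / 2)).

End laplace.

Section gaussian_vector.
Context d (T : measurableType d) (R : realType) (Pr : probability T R).
Variable k : nat.

(* Y is a Gaussian vector: every linear combination of its coordinates is
   normal, where a Dirac measure is a normal law of variance 0. The library's
   normal_prob m 0 is not a Dirac measure, hence the case distinction. *)
Definition gaussian_vector (Y : {RV Pr >-> 'rV[R]_k}) :=
  forall u : 'rV[R]_k, exists m sigma : R, forall A : set R, measurable A ->
    Pr [set w | A (dotv u (Y w))] =
    if sigma == 0 then \d_m A else normal_prob m sigma A.

Definition centered_gaussian (Y : {RV Pr >-> 'rV[R]_k}) (Sigma : 'M[R]_k) :=
  [/\ gaussian_vector Y,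
      forall i, ('E_Pr[fun w => Y w 0%R i] = 0)%E &
      forall i j, covariance Pr (fun w => Y w 0 i) (fun w => Y w 0 j) =
        (Sigma i j)%:E].

End gaussian_vector.

(* Main.v *)
Require Import Defs.
From HB Require Import structures.
From mathcomp Require Import all_boot all_order all_algebra.
From mathcomp Require Import all_classical all_reals all_analysis.
From mathcomp Require Import measurable_realfun complex.
From mathcomp Require Import ring lra.

Set Implicit Arguments.
Unset Strict Implicit.
Unset Printing Implicit Defensive.

Import Order.TTheory GRing.Theory Num.Theory.
Import numFieldNormedType.Exports.

Local Open Scope classical_set_scope.
Local Open Scope ring_scope.

(** On a conical cell the Gaussian integral is homogeneous under s = t / sqrt z,
    so the remainder of the Laplace integral is, with b = aJ and phi = f - f_0,
    the integral of b(s) e^{-z phi(s)} 1_{|s|<r} - a(p) e^{-z <H s, s>/2}. For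
    small r both exponentials are at most e^{-z lambda |s|^2/4}, whence the
    integrand is dominated by the rescaling under s = t / sqrt z of a fixed
    integrable function, independent of p; the part |s| >= r is absorbed by
    1 <= |s| / r.

    The integrals of e^{-<H x, x>/2} and of its product with a cosine follow from
    the one-dimensional case by induction on the dimension, completing the
    square with a Schur complement. Two finite measures on R^d that integrate
    alike every function x |-> cos (<u, x> + t) integrate alike the products of
    step polynomials in sines of linear forms; in the limit they agree on finite
    intersections of half-spaces, which generate the Borel sets. This identifies
    the law of Y. *)

(** * One-dimensional Gaussian integrals *)

(** The Gaussian integrals are computed for 1 + c cos with |c| <= 1 rather than for cos alone. The
    integrand is then nonnegative, so Tonelli's theorem and affine substitutions apply throughout
    the induction before any integrability is known; subtracting the total mass at the end isolates
    the cosine. Cosines with an arbitrary phase replace complex exponentials: their real span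
    contains constants and sines and is closed under products.

    A Gaussian vector is given only through the laws of its one-dimensional projections, which is
    exactly what the integrals of cos (<u, Y> + t) see; the covariance enters through the second
    moments of these projections.

    The radius r is small enough once B r <= lambda / 4, where B bounds the cubic error: then phi >=
    (lambda / 2 - B r) |s|^2 >= lambda |s|^2 / 4. The complex amplitude is handled through its real
    and imaginary parts, which accounts for a factor 2 in the final constant. *)

Lemma dominated_integrable d (T : measurableType d) (R : realType)
    (mu : {measure set T -> \bar R}) (D : set T) (f g : T -> R) :
  measurable D -> measurable_fun D f -> (forall x, D x -> `|f x| <= g x) ->
  mu.-integrable D (EFin \o g) -> mu.-integrable D (EFin \o f).
Proof.
move=> mD mf fg ig; apply: (le_integrable mD _ _ ig) => /=.
  exact/measurable_EFinP.
by move=> x Dx; rewrite lee_fin (le_trans (fg _ Dx))// ler_norm.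
Qed.

Section affine.
Variable R : realType.
Notation mu := (@lebesgue_measure R).
Local Open Scope ereal_scope.

(** Multiplied by a, the pushforward of Lebesgue measure under x |-> a x + c gives each interval ]u,
    v] its length, hence is Lebesgue measure. *)
Lemma ge0_integral_affine (a c : R) (f : R -> \bar R) :
  (0 < a)%R -> measurable_fun setT f -> (forall x, 0 <= f x) ->
  \int[mu]_x f (a * x + c)%R = (a^-1)%:E * \int[mu]_x f x.
Proof.
move=> a0 mf f0.
pose phi := (fun x : R => (a * x + c)%R : measurableTypeR R).
have mphi : measurable_fun setT phi.
  by apply: measurable_funD => //; exact: measurable_funM.
pose m' : {measure set (measurableTypeR R) -> \bar R} :=
  mscale (NngNum (ltW a0)) (pushforward mu phi).
pose m := m' mphi.
have mE A : measurable A -> mu A = m A.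
  apply: lebesgue_measure_unique => _ [[u v] _ <-] /=.
  rewrite /m /m' /= /mscale/= /pushforward.
  have -> : phi @^-1` `]u, v] = `]((u - c) / a)%R, ((v - c) / a)%R]%classic.
    apply/seteqP; split => x /=; rewrite !in_itv/= /phi;
      by rewrite ltr_pdivrMr// ler_pdivlMr// ltrBlDr lerBrDr (mulrC x).
  rewrite !lebesgue_measure_itv/= !lte_fin ltr_pM2r ?invr_gt0// ltrD2r.
  case: ifPn => _; last by rewrite mule0.
  by rewrite -!EFinB -EFinM; congr (_%:E); field; rewrite gt_eqF.
have -> : \int[mu]_x f x = a%:E * \int[mu]_x f (phi x).
  rewrite (@eq_measure_integral _ _ _ _ m); last by move=> A mA _; exact: mE.
  rewrite ge0_integral_mscale//=; congr (_ * _).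
  by rewrite ge0_integral_pushforward// preimage_setT.
by rewrite muleA -EFinM mulVf ?gt_eqF// mul1e.
Qed.

End affine.

(** * Mass, moments and Fourier transform of the Gaussian on the line *)

Section gauss1.
Variable R : realType.
Notation mu := (@lebesgue_measure R).

Definition gaussd (h x : R) : R := expR (- (h * x ^+ 2 / 2)).

Lemma gaussd_ge0 h x : 0 <= gaussd h x. Proof. exact: expR_ge0. Qed.

Lemma continuous_gaussd h : continuous (gaussd h).
Proof.
move=> x; apply: continuous_comp; last exact: continuous_expR.
apply: cvgN; apply: cvgMr_tmp; apply: cvgMl_tmp.
exact: exprn_continuous.
Qed.

Lemma measurable_gaussd h : measurable_fun setT (gaussd h).
Proof. exact: continuous_measurable_fun (@continuous_gaussd h). Qed.

Lemma integral_gaussd h : 0 < h ->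
  (\int[mu]_x (gaussd h x)%:E = (Num.sqrt (2 * pi / h))%:E)%E.
Proof.
move=> h0; have s0 : 0 < Num.sqrt (h / 2) by rewrite sqrtr_gt0 divr_gt0.
transitivity (\int[mu]_x (gauss_fun (Num.sqrt (h / 2) * x + 0))%:E)%E.
  apply: eq_integral => x _; rewrite /gaussd /gauss_fun addr0 exprMn sqr_sqrtr.
    by congr (expR (- _))%:E; rewrite mulrAC.
  by rewrite ltW// divr_gt0.
rewrite (@ge0_integral_affine _ _ _ (fun x => (gauss_fun x)%:E))//; last 2 first.
- by apply/measurable_EFinP; exact: measurable_gauss_fun.
- by move=> x; rewrite lee_fin gauss_fun_ge0.
rewrite integralT_gauss -EFinM; congr (_%:E).
rewrite -sqrtrV ?divr_ge0 ?ltW// -sqrtrM ?invr_ge0 ?divr_ge0 ?ltW//.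
by congr Num.sqrt; field; rewrite gt_eqF.
Qed.

Lemma integrable_gaussd h : 0 < h -> mu.-integrable setT (EFin \o gaussd h).
Proof.
move=> h0; apply/integrableP; split.
  by apply/measurable_EFinP; exact: measurable_gaussd.
under eq_integral do rewrite /= ger0_norm ?gaussd_ge0//.
by rewrite integral_gaussd// ltry.
Qed.

(** One factor absorbs a power of x, the other stays as an integrable majorant. *)
Lemma gaussd_half (x : R) : gaussd 1 x = gaussd (1/2) x * gaussd (1/2) x.
Proof. by rewrite /gaussd -expRD; congr expR; field. Qed.

Lemma le_norm_gaussd (x : R) : `|x| * gaussd 1 x <= gaussd (1/2) x.
Proof.
rewrite gaussd_half mulrA ler_piMl ?gaussd_ge0//.
rewrite /gaussd expRN -ler_pdivlMr ?invr_gt0 ?expR_gt0// mul1r invrK.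
rewrite mul1r; apply: (le_trans _ (expR_ge1Dx _)).
(* The square gives |x| <= 1 + x^2 / 4, and the right-hand side is at most e^(x^2 / 4). *)
have := sqr_ge0 (`|x| / 2 - 1); rewrite -(real_normK (num_real x)); nra.
Qed.

Lemma le_sqr_gaussd (x : R) : x ^+ 2 * gaussd 1 x <= 4 * gaussd (1/2) x.
Proof.
rewrite gaussd_half mulrA ler_wpM2r ?gaussd_ge0//.
rewrite /gaussd expRN -ler_pdivlMr ?invr_gt0 ?expR_gt0// invrK.
have := expR_ge1Dx (1 / 2 * x ^+ 2 / 2); lra.
Qed.

(** Serves as integration by parts on the whole line. Over [-n, n] the integral is F n - F (-n) by
    the fundamental theorem, and dominated convergence passes to the limit. *)
Lemma integral_derivative_eq0 (F f : R -> R) :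
  (forall x : R, is_derive x (1 : R) F (f x)) -> continuous f ->
  mu.-integrable setT (EFin \o f) ->
  F n%:R @[n --> \oo] --> 0 -> F (- n%:R) @[n --> \oo] --> 0 ->
  \int[mu]_x f x = 0.
Proof.
move=> dF cf intf F0 FN0.
pose D (n : nat) : set R := `[- n%:R, n%:R]%classic.
pose f_ n x := ((f \_ (D n)) x)%:E.
have mf : measurable_fun setT f by exact: continuous_measurable_fun.
have mf_ n : measurable_fun setT (f_ n).
  apply/measurable_EFinP/(measurable_restrictT f); first exact: measurable_itv.
  exact: measurable_funS mf.
have f_f x : f_ n x @[n --> \oo] --> (f x)%:E.
  apply: cvg_near_cst; near=> n.
  rewrite /f_ patchE mem_set// /D/= in_itv/= -ler_norml.
  by near: n; exact: nbhs_infty_ger.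
have f_le n x : (`|f_ n x| <= `|f x|%:E)%E.
  rewrite /f_ patchE; case: ifPn => _; rewrite abse_EFin lee_fin//.
  by rewrite normr0 normr_ge0.
have [_ _ cvgI] : [/\ mu.-integrable setT (EFin \o f),
    (\int[mu]_x `|f_ n x - (f x)%:E|)%E @[n --> \oo] --> 0%E &
    (\int[mu]_x f_ n x)%E @[n --> \oo] --> (\int[mu]_x (f x)%:E)%E].
  apply: (@dominated_convergence _ _ _ mu setT _ f_ (EFin \o f)
      (fun x => `|f x|%:E)) => //.
  - exact/measurable_EFinP.
  - by apply: aeW => x _; exact: f_f.
  - by have := integrable_abse intf.
  - by apply: aeW => x n _; exact: f_le.
suff : (\int[mu]_x f_ n x)%E @[n --> \oo] --> 0%E.
  by move=> /(cvg_unique _ cvgI) h; rewrite /Rintegral h.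
have FF : (F n%:R - F (- n%:R))%:E @[n --> \oo] --> 0%E.
  apply: cvg_EFin; first exact: nearW.
  by rewrite -[X in _ --> X](subrr 0); exact: cvgB F0 FN0.
apply: cvg_trans FF; apply: near_eq_cvg; near=> n; rewrite EFinB.
have n0 : - n%:R < n%:R :> R.
  by rewrite gtrN// ltr0n; near: n; exists 1%N.
rewrite /f_ -(@continuous_FTC2 _ f F _ _ n0)//.
- rewrite [LHS]integral_mkcond; apply: eq_integral => x _.
  by rewrite !patchE; case: ifPn.
- exact: continuous_subspaceT.
- split.
  + by move=> x _; exact: ex_derive.
  + apply: cvg_at_right_filter; apply: differentiable_continuous.
    by apply/derivable1_diffP; exact: ex_derive.
  + apply: cvg_at_left_filter; apply: differentiable_continuous.
    by apply/derivable1_diffP; exact: ex_derive.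
- by move=> x _; rewrite derive1E; exact: derive_val.
Unshelve. all: end_near. Qed.

Lemma cvg_gaussd_half (c : R) : c * gaussd (1/2) n%:R @[n --> \oo] --> 0.
Proof.
rewrite -[X in _ --> X](mulr0 c); apply: cvgMl_tmp.
have -> : (fun n => gaussd (1/2) n%:R) = (fun n : nat => gauss_fun (n%:R / 2)) :> (nat -> R).
  by apply/funext => n; rewrite /gaussd /gauss_fun; congr expR; field.
apply: (cvg_comp (fun n : nat => n%:R / 2 : R) (@gauss_fun R)); last first.
  exact: cvg_gauss_fun.
have h2 : 0 < 2^-1 :> R by rewrite invr_gt0.
apply: (cvg_comp (fun n : nat => n%:R : R) (fun x : R => x / 2)).
  exact: cvgr_idn.
exact: (gt0_cvgMly h2 cvg_id).
Qed.

Lemma gaussdN h x : gaussd h (- x) = gaussd h x.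
Proof. by rewrite /gaussd sqrrN. Qed.

Lemma cvg_le_gaussd (F : R -> R) (c : R) :
  (forall x, `|F x| <= c * gaussd (1/2) x) ->
  F n%:R @[n --> \oo] --> 0 /\ F (- n%:R) @[n --> \oo] --> 0.
Proof.
move=> Fc; split; apply: norm_cvg0;
  apply: (@squeeze_cvgr _ _ _ _ (cst 0) (fun n : nat => c * gaussd (1/2) n%:R));
  [|exact: cvg_cst|exact: cvg_gaussd_half| |exact: cvg_cst|exact: cvg_gaussd_half];
  apply: nearW => n; rewrite normr_ge0/=; first exact: Fc.
by rewrite -gaussdN; exact: Fc.
Qed.

Lemma is_derive_mull (a x : R) : is_derive x (1 : R) (fun x => a * x) a.
Proof.
have := is_deriveZ a (is_derive_id x (1 : R)).
by rewrite [X in is_derive _ _ _ X](_ : _ = a) //; exact: mulr1.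
Qed.

Lemma is_derive_gaussd h x : is_derive x (1 : R) (gaussd h) (- (h * x) * gaussd h x).
Proof.
have d1 := is_deriveX 2 (is_derive_id x (1 : R)).
have d2 := is_deriveZ (- (h / 2)) d1.
have := is_derive1_comp (is_derive_expR _) d2.
rewrite [X in is_derive _ _ X _](_ : _ = gaussd h); last first.
  apply/funext => y; transitivity (expR (- (h / 2) * y ^+ 2)) => //.
  by congr expR; rewrite mulNr mulrAC.
rewrite [X in is_derive _ _ _ X -> _](_ : _ = - (h * x) * gaussd h x)//.
transitivity (expR (- (h / 2) * x ^+ 2) * (- (h / 2) * (2 * x))).
  by rewrite /GRing.scale/= expr1 mulr1.
by rewrite (_ : - (h / 2) * x ^+ 2 = - (h * x ^+ 2 / 2)) /gaussd; field.
Qed.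

Lemma integral_gaussd1 : \int[mu]_x gaussd 1 x = Num.sqrt (2 * pi).
Proof. by rewrite /Rintegral integral_gaussd// divr1. Qed.

Lemma integrable_le_gaussd (f : R -> R) (c h : R) : 0 < h -> continuous f ->
  (forall x, `|f x| <= c * gaussd h x) -> mu.-integrable setT (EFin \o f).
Proof.
move=> h0 cf fc.
apply: (@dominated_integrable _ _ _ mu setT f (fun x => c * gaussd h x)) => //.
- exact: continuous_measurable_fun.
- have := integrableZl measurableT c (integrable_gaussd h0).
  by apply: eq_integrable => // x _ /=; rewrite EFinM.
Qed.

Lemma moment1_gaussd : \int[mu]_x (x * gaussd 1 x) = 0.
Proof.
have /cvg_le_gaussd[F0 FN0] : forall x, `|- gaussd 1 x| <= 1 * gaussd (1/2) x.
  move=> x; rewrite normrN ger0_norm ?gaussd_ge0// mul1r /gaussd ler_expR.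
  by have := sqr_ge0 x; lra.
apply: (@integral_derivative_eq0 (fun x => - gaussd 1 x)) => //.
- move=> x; have := is_deriveN (is_derive_gaussd 1 x).
  by rewrite !mulNr opprK mul1r.
- by move=> x; apply: cvgM; [exact: cvg_id|exact: continuous_gaussd].
- apply: (@integrable_le_gaussd _ 1 (1/2)) => //.
    by move=> x; apply: cvgM; [exact: cvg_id|exact: continuous_gaussd].
  by move=> x; rewrite normrM mul1r (ger0_norm (gaussd_ge0 _ _)) le_norm_gaussd.
Qed.

Lemma integrable_sqr_gaussd : mu.-integrable setT (EFin \o (fun x => x ^+ 2 * gaussd 1 x)).
Proof.
apply: (@integrable_le_gaussd _ 4 (1/2)) => //.
  by move=> x; apply: cvgM; [exact: exprn_continuous|exact: continuous_gaussd].
by move=> x; rewrite ger0_norm ?le_sqr_gaussd// mulr_ge0 ?gaussd_ge0 ?sqr_ge0.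
Qed.

(** The derivative of [x * gaussd 1 x] is [gaussd 1 x - x ^+ 2 * gaussd 1 x], so the second moment
    equals the mass. *)
Lemma moment2_gaussd : \int[mu]_x (x ^+ 2 * gaussd 1 x) = Num.sqrt (2 * pi).
Proof.
have /cvg_le_gaussd[F0 FN0] : forall x, `|x * gaussd 1 x| <= 1 * gaussd (1/2) x.
  by move=> x; rewrite normrM mul1r (ger0_norm (gaussd_ge0 _ _)) le_norm_gaussd.
have : \int[mu]_x (gaussd 1 x - x ^+ 2 * gaussd 1 x) = 0.
  apply: (@integral_derivative_eq0 (fun x => x * gaussd 1 x)) => //.
  - move=> x; have := is_deriveM (is_derive_id x (1:R)) (is_derive_gaussd 1 x).
    rewrite [X in is_derive _ _ _ X -> _](_ : _ = gaussd 1 x - x ^+ 2 * gaussd 1 x)//.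
    by rewrite /GRing.scale/=; ring.
  - move=> x; apply: cvgB; first exact: continuous_gaussd.
    by apply: cvgM; [exact: exprn_continuous|exact: continuous_gaussd].
  - have := integrableB measurableT (integrable_gaussd ltr01) integrable_sqr_gaussd.
    by apply: eq_integrable.
rewrite RintegralB//; [|exact: integrable_gaussd|exact: integrable_sqr_gaussd].
by rewrite integral_gaussd1 => /eqP; rewrite subr_eq0 => /eqP.
Qed.

Lemma continuous_cos_gaussd (h w t : R) :
  continuous (fun x => cos (w * x + t) * gaussd h x).
Proof.
move=> x; apply: cvgM; last exact: continuous_gaussd.
apply: continuous_comp; last exact: continuous_cos.
by apply: cvgD; [apply: cvgMl_tmp; exact: cvg_id|exact: cvg_cst].
Qed.

Lemma continuous_sin_gaussd (h w t : R) :
  continuous (fun x => sin (w * x + t) * gaussd h x).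
Proof.
move=> x; apply: cvgM; last exact: continuous_gaussd.
apply: continuous_comp; last exact: continuous_sin.
by apply: cvgD; [apply: cvgMl_tmp; exact: cvg_id|exact: cvg_cst].
Qed.

Lemma integrable_cos_gaussd h w t : 0 < h ->
  mu.-integrable setT (EFin \o (fun x => cos (w * x + t) * gaussd h x)).
Proof.
move=> h0; apply: (@integrable_le_gaussd _ 1 h) => //.
  exact: continuous_cos_gaussd.
move=> x; rewrite normrM (ger0_norm (gaussd_ge0 _ _)).
by rewrite ler_wpM2r ?gaussd_ge0 ?cos_max.
Qed.

(** Differentiation under the integral produces minus the integral of x sin (w x + t) e^(-x^2/2),
    with [gaussd (1/2)] as majorant for every frequency. Integrating the derivative of sin (w x + t)
    e^(-x^2/2) identifies this with -w times the original integral. *)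
Lemma derive_fourier_gaussd (t w : R) :
  is_derive w (1 : R) (fun w => \int[mu]_x (cos (w * x + t) * gaussd 1 x))
    (- w * \int[mu]_x (cos (w * x + t) * gaussd 1 x)).
Proof.
pose f (w x : R) := cos (w * x + t) * gaussd 1 x.
have df (v x : R) : is_derive v (1 : R) (f ^~ x) (- (x * sin (v * x + t) * gaussd 1 x)).
  have d0 : is_derive v (1 : R) (fun v => v * x + t) x.
    have := is_deriveD (is_derive_mull x v) (is_derive_cst t v (1 : R)).
    rewrite addr0; congr is_derive; apply/funext => y.
    by rewrite -[LHS]/(x * y + t) mulrC.
  have := is_deriveZ (gaussd 1 x) (is_derive1_comp (is_derive_cos _) d0).
  rewrite [X in is_derive _ _ X _ -> _](_ : _ = f ^~ x); last first.
    by apply/funext => y; rewrite /f mulrC.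
  rewrite [X in is_derive _ _ _ X -> _](_ : _ = - (x * sin (v * x + t) * gaussd 1 x))//.
  by rewrite /GRing.scale/=; ring.
have fI v : `](w - 1), (w + 1)[%classic v -> mu.-integrable setT (EFin \o f v).
  by move=> _; exact: integrable_cos_gaussd.
have wI : `](w - 1), (w + 1)[%classic w by rewrite /= in_itv/= ltrBlDr ltrDl ltr01.
have fd (v x : R) : `](w - 1), (w + 1)[%classic v -> [set: R] x -> derivable (f ^~ x) v 1.
  by move=> _ _; have [] := df v x.
have G0 (x : R) : 0 <= gaussd (1/2) x := gaussd_ge0 _ _.
have iG := @integrable_gaussd (1/2) ltac:(lra).
have fG (v x : R) : `](w - 1), (w + 1)[%classic v -> [set: R] x ->
    `|partial1of2 f v x| <= gaussd (1/2) x.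
  move=> _ _; rewrite partial1of2E (@derive_val _ _ _ _ _ _ _ (df v x)) normrN.
  rewrite 2!normrM (ger0_norm (gaussd_ge0 _ _)) (le_trans _ (le_norm_gaussd x))//.
  by rewrite ler_wpM2r ?gaussd_ge0// ler_piMr// sin_max.
have D1 := derivable_under_integral measurableT wI fI fd G0 iG fG.
have D2 := differentiation_under_integral measurableT wI fI fd G0 iG fG.
apply: DeriveDef; first exact: D1.
rewrite -derive1E D2.
have -> : \int[mu]_y (partial1of2 f)^~ y w =
          \int[mu]_x (- (x * sin (w * x + t) * gaussd 1 x)).
  by apply: eq_Rintegral => x _; rewrite partial1of2E derive_val.
have cxs : continuous (fun x : R => - (x * sin (w * x + t) * gaussd 1 x)).
  move=> x; apply: cvgN; rewrite -mulrA.
  under eq_fun do rewrite -mulrA.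
  by apply: cvgM; [exact: cvg_id|exact: continuous_sin_gaussd].
have ixs : mu.-integrable setT (EFin \o (fun x : R => - (x * sin (w * x + t) * gaussd 1 x))).
  apply: (@integrable_le_gaussd _ 1 (1/2)) => // x.
  rewrite normrN 2!normrM (ger0_norm (gaussd_ge0 _ _)) mul1r.
  rewrite (le_trans _ (le_norm_gaussd x))//.
  by rewrite ler_wpM2r ?gaussd_ge0// ler_piMr// sin_max.
have icos := @integrable_cos_gaussd 1 w t ltr01.
have /cvg_le_gaussd[F0 FN0] : forall x, `|sin (w * x + t) * gaussd 1 x| <= 1 * gaussd (1/2) x.
  move=> x; rewrite normrM (ger0_norm (gaussd_ge0 _ _)).
  rewrite (@le_trans _ _ (1 * gaussd 1 x)) ?ler_wpM2r ?gaussd_ge0 ?sin_max//.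
  by rewrite !mul1r /gaussd ler_expR; have := sqr_ge0 x; lra.
have : \int[mu]_x (w * (cos (w * x + t) * gaussd 1 x) + - (x * sin (w * x + t) * gaussd 1 x)) = 0.
  apply: (@integral_derivative_eq0 (fun x => sin (w * x + t) * gaussd 1 x)) => //.
  - move=> x.
    have d0 : is_derive x (1 : R) (fun v => w * v + t) w.
      have := is_deriveD (is_derive_mull w x) (is_derive_cst t x (1 : R)).
      by rewrite addr0.
    have := is_deriveM (is_derive1_comp (is_derive_sin _) d0) (is_derive_gaussd 1 x).
    rewrite [X in is_derive _ _ _ X -> _](_ : _ = w * (cos (w * x + t) * gaussd 1 x) + - (x * sin (w * x + t) * gaussd 1 x))//.
    by rewrite /GRing.scale/=; ring.
  - move=> x; apply: cvgD; last exact: cxs.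
    by apply: cvgMl_tmp; exact: continuous_cos_gaussd.
  - have := integrableD measurableT (integrableZl measurableT w icos) ixs.
    by apply: eq_integrable.
rewrite RintegralD//; last first.
  by have := integrableZl measurableT w icos; exact: eq_integrable.
rewrite RintegralZl// => /eqP; rewrite addrC addr_eq0 => /eqP ->.
by rewrite mulNr.
Qed.

(** The integral solves y' = - w y, so its product with the integrating factor e^(w^2/2), written
    [gaussd (-1) w], is constant; the constant is read off at w = 0. *)
Lemma fourier_gaussd1 (t w : R) : \int[mu]_x (cos (w * x + t) * gaussd 1 x) =
  Num.sqrt (2 * pi) * gaussd 1 w * cos t.
Proof.
pose K w := \int[mu]_x (cos (w * x + t) * gaussd 1 x) * gaussd (-1) w.
have K' v : is_derive v (1 : R) K 0.
  have := is_deriveM (derive_fourier_gaussd t v) (is_derive_gaussd (-1) v).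
  rewrite [X in is_derive _ _ _ X -> _](_ : _ = 0)//.
  by rewrite /GRing.scale/=; ring.
have := is_derive_0_is_cst w 0 K'; rewrite /K => KE.
have g1 v : gaussd (-1) v * gaussd 1 v = 1.
  by rewrite /gaussd -expRD -[RHS]expR0; congr expR; ring.
set X := (LHS); have -> : X = X * gaussd (-1) w * gaussd 1 w.
  by rewrite -mulrA g1 mulr1.
rewrite /X KE [RHS]mulrAC; congr (_ * _).
rewrite [X in _ * X](_ : _ = 1) ?mulr1; last first.
  by rewrite /gaussd expr0n/= mulr0 mul0r oppr0 expR0.
rewrite -integral_gaussd1 mulrC -RintegralZl//; last exact: integrable_gaussd.
by apply: eq_Rintegral => x _; rewrite mul0r add0r.
Qed.

(** Substituting y = sqrt h (x + s) reduces this to h = 1; the shift s only changes the phase, by -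
    w s. It is stated with extended-real values so that it can be used inside an iterated
    integral. *)
Lemma ge0_integral_cos_gaussd (h s w c t : R) : 0 < h -> `|c| <= 1 ->
  (\int[mu]_x ((1 + c * cos (w * x + t)) * gaussd h (x + s))%:E =
   (Num.sqrt (2 * pi / h) * (1 + c * gaussd h^-1 w * cos (t - w * s)))%:E)%E.
Proof.
move=> h0 c1.
have rh0 : 0 < Num.sqrt h by rewrite sqrtr_gt0.
pose w' := w / Num.sqrt h; pose t' := t - w * s.
pose f y := ((1 + c * cos (w' * y + t')) * gaussd 1 y).
have f0 y : 0 <= f y.
  rewrite mulr_ge0 ?gaussd_ge0//.
  suff : `|c * cos (w' * y + t')| <= 1 by rewrite ler_norml; lra.
  by rewrite normrM mulr_ile1// cos_max.
have cf : continuous f.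
  move=> y; apply: cvgM; last exact: continuous_gaussd.
  apply: cvgD; first exact: cvg_cst.
  apply: cvgMl_tmp; apply: continuous_comp; last exact: continuous_cos.
  by apply: cvgD; [apply: cvgMl_tmp; exact: cvg_id|exact: cvg_cst].
transitivity (\int[mu]_x (f (Num.sqrt h * x + Num.sqrt h * s))%:E)%E.
  apply: eq_integral => x _; rewrite /f /w' /t'; congr (((1 + c * cos _) * expR (- _))%:E).
    by field; rewrite gt_eqF.
  by rewrite -mulrDr exprMn sqr_sqrtr ?ltW// mul1r.
rewrite (@ge0_integral_affine _ _ _ (fun x => (f x)%:E))//; last first.
  by apply/measurable_EFinP; exact: continuous_measurable_fun.
have i1 := @integrable_gaussd 1 ltr01.
have i2 := @integrable_cos_gaussd 1 w' t' ltr01.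
have i3 : mu.-integrable setT (EFin \o (fun x => c * (cos (w' * x + t') * gaussd 1 x))).
  by have := integrableZl measurableT c i2; exact: eq_integrable.
have intf : mu.-integrable setT (EFin \o f).
  have := integrableD measurableT i1 i3; apply: eq_integrable => // x _.
  by rewrite /= /f -EFinD; congr EFin; ring.
have -> : (\int[mu]_x (f x)%:E = (\int[mu]_x f x)%:E)%E.
  by rewrite /Rintegral fineK//; exact: integrable_fin_num.
have -> : \int[mu]_x f x = Num.sqrt (2 * pi) * (1 + c * gaussd h^-1 w * cos t').
  transitivity (\int[mu]_x (gaussd 1 x + c * (cos (w' * x + t') * gaussd 1 x))).
    by apply: eq_Rintegral => x _; rewrite /f; ring.
  rewrite RintegralD// RintegralZl// integral_gaussd1 fourier_gaussd1.
  have -> : gaussd h^-1 w = gaussd 1 w'.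
    by rewrite /gaussd /w' expr_div_n sqr_sqrtr ?ltW// mul1r (mulrC h^-1).
  ring.
rewrite -EFinM mulrA; congr ((_ * _)%:E).
have -> : Num.sqrt (2 * pi / h) = Num.sqrt (2 * pi) * Num.sqrt h^-1.
  by rewrite sqrtrM// mulr_ge0 ?pi_ge0.
by rewrite sqrtrV ?ltW// mulrC.
Qed.

End gauss1.

(** * Gaussian integrals on row vectors *)

Section lebesgue_rV_integral.
Variable R : realType.
Notation mu := (@lebesgue_measure R).
Local Open Scope ereal_scope.

Lemma lebesgue_rVSE n (A : set 'rV[R]_n.+1) : measurable A ->
  lebesgue_rV A = (mu \x @lebesgue_rV R n) (@rV_cons R n @^-1` A).
Proof.
move=> mA; rewrite /= /product_measure1/=; apply: eq_integral => x _ /=.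
congr (lebesgue_rV _); apply/seteqP; split => v /=; by rewrite /xsection/= inE.
Qed.

Lemma measurable_rV_cons_fun n (f : 'rV[R]_n.+1 -> \bar R) :
  measurable_fun setT f -> measurable_fun setT (f \o @rV_cons R n).
Proof. by move=> mf; apply: measurableT_comp => //; exact: measurable_rV_cons. Qed.

Lemma ge0_integral_rV_prod n (f : 'rV[R]_n.+1 -> \bar R) :
  measurable_fun setT f -> (forall v, 0 <= f v) ->
  \int[@lebesgue_rV R n.+1]_v f v =
  \int[mu \x @lebesgue_rV R n]_p f (rV_cons p).
Proof.
move=> mf f0.
pose m' : {measure set 'rV[R]_n.+1 -> \bar R} :=
  pushforward (mu \x @lebesgue_rV R n) (@rV_cons R n).
pose m := m' (@measurable_rV_cons R n).
rewrite (@eq_measure_integral _ _ _ _ m); last first.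
  by move=> A mA _; rewrite /m /m'/=; exact: lebesgue_rVSE.
rewrite /m /m' ge0_integral_pushforward ?preimage_setT//.
exact: measurable_rV_cons.
Qed.

Lemma ge0_integral_rVS n (f : 'rV[R]_n.+1 -> \bar R) :
  measurable_fun setT f -> (forall v, 0 <= f v) ->
  \int[@lebesgue_rV R n.+1]_v f v =
  \int[mu]_x \int[@lebesgue_rV R n]_v f (rV_cons (x, v)).
Proof.
move=> mf f0; rewrite ge0_integral_rV_prod//.
exact: (fubini_tonelli1 (m1 := mu) (m2 := @lebesgue_rV R n) (f \o @rV_cons R n) (measurable_rV_cons_fun mf)
  (fun p => f0 (rV_cons p))).
Qed.

(** With the first coordinate innermost, the square can be completed in it while the remaining
    coordinates are fixed. *)
Lemma ge0_integral_rVS2 n (f : 'rV[R]_n.+1 -> \bar R) :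
  measurable_fun setT f -> (forall v, 0 <= f v) ->
  \int[@lebesgue_rV R n.+1]_v f v =
  \int[@lebesgue_rV R n]_v \int[mu]_x f (rV_cons (x, v)).
Proof.
move=> mf f0; rewrite ge0_integral_rV_prod//.
exact: (fubini_tonelli2 (m1 := mu) (m2 := @lebesgue_rV R n) (f \o @rV_cons R n) (measurable_rV_cons_fun mf)
  (fun p => f0 (rV_cons p))).
Qed.

Lemma integral_rV0 (f : 'rV[R]_0 -> \bar R) : measurable_fun setT f ->
  \int[@lebesgue_rV R 0]_v f v = f 0%R.
Proof.
move=> mf; rewrite (@eq_measure_integral _ _ _ _ (@dirac _ 'rV[R]_0 0%R R))//.
by rewrite integral_dirac// diracT mul1e.
Qed.

Lemma rV_consZ n (c x : R) (v : 'rV[R]_n) :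
  c *: rV_cons (x, v) = rV_cons (c * x, c *: v)%R.
Proof.
apply/rowP => i; rewrite mxE; case: (unliftP 0%R i) => [j ->|->].
  by rewrite !rV_consS/= mxE.
by rewrite !rV_cons0.
Qed.

Lemma measurable_scale n (c : R) :
  measurable_fun setT (fun v : 'rV[R]_n => c *: v).
Proof. by apply: continuous_measurable_mx; exact: scaler_continuous. Qed.

(** By induction: the inner integral over the tail contributes c^-n, and the substitution in the
    first coordinate one more factor c^-1. *)
Lemma ge0_integral_scale n (c : R) (f : 'rV[R]_n -> \bar R) : (0 < c)%R ->
  measurable_fun setT f -> (forall v, 0 <= f v) ->
  \int[@lebesgue_rV R n]_v f (c *: v) =
  (c ^- n)%:E * \int[@lebesgue_rV R n]_v f v.
Proof.
move=> c0; elim: n f => [|n IHn] f mf f0.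
  rewrite !integral_rV0 ?scaler0 ?expr0 ?invr1 ?mul1e//.
  exact: measurableT_comp (measurable_scale c).
have mfc : measurable_fun setT (fun v : 'rV[R]_n.+1 => f (c *: v)).
  exact: measurableT_comp (measurable_scale c).
rewrite ge0_integral_rVS// ge0_integral_rVS//.
have mx x : measurable_fun setT (fun v : 'rV[R]_n => f (rV_cons (x, v))).
  exact: measurableT_comp (measurable_rV_cons_fun mf) (pair1_measurable x).
under eq_integral => x _.
  under eq_integral do rewrite rV_consZ.
  rewrite (IHn (fun v => f (rV_cons ((c * x)%R, v))))//; first over.
have mg := measurable_fun_fubini_tonelli_F (m2 := @lebesgue_rV R n)
  _ (measurable_rV_cons_fun mf) (fun p => f0 (rV_cons p)).
have g0 x : 0 <= \int[@lebesgue_rV R n]_v f (rV_cons (x, v)).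
  by apply: integral_ge0 => v _; exact: f0.
pose g := (fun x => \int[@lebesgue_rV R n]_v f (rV_cons (x, v))).
have mgc : measurable_fun setT (fun x => g (c * x)%R).
  apply: (measurableT_comp (f := g)); first exact: mg.
  exact: measurable_funM.
have cn0 : (0 <= c ^- n)%R by rewrite invr_ge0 exprn_ge0// ltW.
transitivity (\int[mu]_x ((c ^- n)%:E * g (c * x)%R)) => //.
rewrite (@ge0_integralZl _ _ _ mu setT measurableT (fun x => g (c * x)%R)
  mgc (c ^- n)%:E (fun x _ => g0 (c * x)%R)); last by rewrite lee_fin.
have -> : \int[mu]_x g (c * x)%R = \int[mu]_x g (c * x + 0)%R.
  by apply: eq_integral => x _; rewrite addr0.
rewrite (ge0_integral_affine 0 c0 mg g0) muleA -EFinM; congr (_%:E * _).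
by rewrite exprSr invfM mulrC.
Qed.

End lebesgue_rV_integral.

Section dotv_qform.
Variable R : realType.

Lemma dotvE n (u v : 'rV[R]_n) : dotv u v = (u *m v^T) 0 0.
Proof. by rewrite mxE; apply: eq_bigr => i _; rewrite mxE. Qed.

Lemma dotvC n (u v : 'rV[R]_n) : dotv u v = dotv v u.
Proof. by apply: eq_bigr => i _; rewrite mulrC. Qed.

Lemma dotvDl n (u v w : 'rV[R]_n) : dotv (u + v) w = dotv u w + dotv v w.
Proof. by rewrite -big_split; apply: eq_bigr => i _; rewrite mxE mulrDl. Qed.

Lemma dotvZl n c (u w : 'rV[R]_n) : dotv (c *: u) w = c * dotv u w.
Proof. by rewrite /dotv mulr_sumr; apply: eq_bigr => i _; rewrite mxE mulrA. Qed.

Lemma dotvNl n (u w : 'rV[R]_n) : dotv (- u) w = - dotv u w.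
Proof. by rewrite -scaleN1r dotvZl mulN1r. Qed.

Lemma dotvZr n c (u w : 'rV[R]_n) : dotv w (c *: u) = c * dotv w u.
Proof. by rewrite !(dotvC w) dotvZl. Qed.

Lemma dotv0l n (u : 'rV[R]_n) : dotv 0 u = 0.
Proof. by rewrite -(scale0r u) dotvZl mul0r. Qed.

Lemma dotv_row n (x y : R) (u v : 'rV[R]_n) :
  dotv (rV_cons (x, u)) (rV_cons (y, v)) = x * y + dotv u v.
Proof.
rewrite /dotv big_ord_recl !rV_cons0; congr (_ + _).
by apply: eq_bigr => i _; rewrite !rV_consS.
Qed.

Lemma qformZ n (H : 'M[R]_n) c t : qform H (c *: t) = c ^+ 2 * qform H t.
Proof. by rewrite /qform -scalemxAl dotvZl dotvZr mulrA expr2. Qed.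

Lemma dotv_ge0 n (u : 'rV[R]_n) : 0 <= dotv u u.
Proof. by apply: sumr_ge0 => i _; rewrite -expr2 sqr_ge0. Qed.

Lemma enorm_ge0 n (u : 'rV[R]_n) : 0 <= enorm u.
Proof. exact: sqrtr_ge0. Qed.

Lemma enorm2 n (u : 'rV[R]_n) : enorm u ^+ 2 = dotv u u.
Proof. by rewrite sqr_sqrtr// dotv_ge0. Qed.

Lemma enormZ n c (u : 'rV[R]_n) : 0 <= c -> enorm (c *: u) = c * enorm u.
Proof.
move=> c0; rewrite /enorm dotvZl dotvZr mulrA -expr2 sqrtrM ?sqr_ge0//.
by rewrite sqrtr_sqr ger0_norm.
Qed.

Lemma dotv_gt0 n (u : 'rV[R]_n) : u != 0 -> 0 < dotv u u.
Proof.
move=> u0; rewrite lt_neqAle dotv_ge0 andbT eq_sym; apply: contra u0.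
rewrite psumr_eq0; last by move=> i _; rewrite -expr2 sqr_ge0.
move=> /allP h; apply/eqP/rowP => i; rewrite mxE; apply/eqP.
by have := h i (mem_index_enum _); rewrite -expr2 sqrf_eq0.
Qed.

Lemma measurable_dotv n (u : 'rV[R]_n) : measurable_fun setT (dotv u).
Proof.
apply: measurable_sum => i; apply: measurable_funM => //.
exact: measurable_coord.
Qed.

Lemma measurable_dotvv n : measurable_fun setT (fun u : 'rV[R]_n => dotv u u).
Proof.
apply: measurable_sum => i; apply: measurable_funM; exact: measurable_coord.
Qed.

Lemma measurable_enorm n : measurable_fun setT (@enorm R n).
Proof.
have ms : measurable_fun setT (@Num.sqrt R).
  exact: continuous_measurable_fun (@sqrt_continuous R).
exact: measurableT_comp ms (@measurable_dotvv n).
Qed.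

Lemma measurable_qform n (H : 'M[R]_n) : measurable_fun setT (qform H).
Proof.
apply: measurable_sum => i; apply: measurable_funM; last exact: measurable_coord.
under eq_fun do rewrite mxE; apply: measurable_sum => j.
apply: measurable_funM => //; exact: measurable_coord.
Qed.

Lemma measurable_eball n (r : R) : measurable (@eball R n r).
Proof.
have := @measurable_enorm n measurableT _ (measurable_itv `]-oo, r[).
by rewrite setTI; congr measurable.
Qed.

End dotv_qform.

(** * Schur complements and the Gaussian integral in dimension n *)

Section gaussian_rV.
Variable R : realType.
Notation mu := (@lebesgue_measure R).

Lemma rV_consE n (x : R) (v : 'rV[R]_n) : rV_cons (x, v) = row_mx x%:M v.
Proof. by []. Qed.

Definition schur n (H : 'M[R]_n.+1) : 'M[R]_n :=
  let b : 'rV[R]_n := ursubmx (H : 'M[R]_(1 + n, 1 + n)) in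
  drsubmx (H : 'M[R]_(1 + n, 1 + n)) - (H 0 0)^-1 *: (b^T *m b).

Section schur_complement.
Variables (n : nat) (H : 'M[R]_n.+1).
Hypothesis H_sym : H^T = H.
Let h := H 0 0.
Let b : 'rV[R]_n := ursubmx (H : 'M[R]_(1 + n, 1 + n)).
Let D : 'M[R]_n := drsubmx (H : 'M[R]_(1 + n, 1 + n)).
Let S := schur H.

Lemma schur_block : H = block_mx h%:M b b^T D :> 'M[R]_(1 + n, 1 + n).
Proof.
rewrite -[LHS](@submxK _ 1 n 1 n); congr block_mx.
  rewrite [LHS]mx11_scalar; congr (_%:M); rewrite !mxE.
  by congr (H _ _); exact/val_inj.
by rewrite /b trmx_ursub H_sym.
Qed.

Lemma rV_cons_mul (x : R) (v : 'rV[R]_n) :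
  rV_cons (x, v) *m H = rV_cons (h * x + dotv b v, x *: b + v *m D).
Proof.
rewrite schur_block !rV_consE.
rewrite (@mul_row_block _ 1 1 n 1 n); apply: (congr2 (@row_mx R 1 1 n)).
  2: by rewrite mul_scalar_mx.
rewrite mul_scalar_mx scale_scalar_mx [v *m b^T]mx11_scalar -dotvE (dotvC v).
by rewrite raddfD/= mulrC.
Qed.

Lemma schur_sym : S^T = S.
Proof.
rewrite /S /schur linearB/= linearZ/= trmx_mul trmxK; congr (_ - _).
by rewrite trmx_drsub H_sym.
Qed.

Lemma mul_schur (v : 'rV[R]_n) : v *m S = v *m D - (h^-1 * dotv b v) *: b.
Proof.
rewrite /S /schur -/b -/D -/h mulmxBr -scalemxAr mulmxA; congr (_ - _).
by rewrite [v *m b^T]mx11_scalar -dotvE (dotvC b) mul_scalar_mx scalerA.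
Qed.

Lemma qform_schur (x : R) (v : 'rV[R]_n) : h != 0 ->
  qform H (rV_cons (x, v)) = h * (x + h^-1 * dotv b v) ^+ 2 + qform S v.
Proof.
move=> h0; rewrite /qform rV_cons_mul dotv_row mul_schur dotvDl dotvZl.
rewrite dotvDl dotvNl dotvZl.
by field.
Qed.

(** The linear form splits along the same shifted variable as the square in [qform_schur], and its
    remaining part has again the shape w S, ready for the induction hypothesis. *)
Lemma dotv_schur (x0 y0 : R) (v w : 'rV[R]_n) : h != 0 ->
  let q := h * y0 + dotv b w in
  dotv (rV_cons (y0, w) *m H) (rV_cons (x0, v)) =
  q * (x0 + h^-1 * dotv b v) + dotv (w *m S) v.
Proof.
move=> h0; rewrite /= rV_cons_mul dotv_row mul_schur.
rewrite !dotvDl dotvNl !dotvZl.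
by field.
Qed.

Lemma det_schur : h != 0 -> \det H = h * \det S.
Proof.
(* Block LU factorization: a unipotent lower factor times a block upper triangular one. *)
move=> h0; have -> : H = block_mx 1%:M 0 (h^-1 *: b^T) 1%:M *m
    block_mx h%:M b 0 S :> 'M[R]_(1 + n, 1 + n).
  rewrite [LHS]schur_block (@mulmx_block _ 1 n 1 n 1 n).
  rewrite !mul1mx ?mul0mx ?mulmx0 ?addr0 ?add0r.
  congr block_mx.
    by rewrite mul_mx_scalar scalerA divff// scale1r.
  by rewrite /S /schur -scalemxAl addrC subrK.
by rewrite det_mulmx (@det_lblock _ 1 n) (@det_ublock _ 1 n) !det1 !mul1r det_scalar1.
Qed.

Hypothesis H_gt0 : forall t, t != 0 -> 0 < qform H t.

Lemma schur_pivot_gt0 : 0 < h.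
Proof.
have := H_gt0 (t := rV_cons (1, 0)).
rewrite /qform rV_cons_mul dotv_row (dotvC b) !dotv0l.
rewrite dotvC dotv0l !addr0 !mulr1; apply; apply/eqP => /rowP/(_ 0).
by rewrite rV_cons0 mxE => /eqP; rewrite oner_eq0.
Qed.

Lemma schur_gt0 (v : 'rV[R]_n) : v != 0 -> 0 < qform S v.
Proof.
move=> v0; have h0 : h != 0 by rewrite gt_eqF// schur_pivot_gt0.
(* This first coordinate makes the completed square vanish, so that only the Schur complement is
   left. *)
have := H_gt0 (t := rV_cons (- (h^-1 * dotv b v), v)).
rewrite qform_schur// addNr expr0n/= mulr0 add0r; apply.
apply: contra v0 => /eqP/rowP e; apply/eqP/rowP => i.
by have := e (lift 0 i); rewrite rV_consS !mxE.
Qed.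

End schur_complement.

Lemma measurable_gauss n (H : 'M[R]_n) :
  measurable_fun setT (fun x => expR (- (qform H x / 2))).
Proof.
have mq : measurable_fun setT (fun x => - (qform H x / 2)).
  apply: measurable_funN; apply: measurable_funM => //; exact: measurable_qform.
exact: measurableT_comp mq.
Qed.

Lemma measurable_cos_dotv n (u : 'rV[R]_n) t :
  measurable_fun setT (fun x => cos (dotv u x + t)).
Proof.
have md : measurable_fun setT (fun x => dotv u x + t).
  by apply: measurable_funD => //; exact: measurable_dotv.
have mc : measurable_fun setT (@cos R).
  exact: continuous_measurable_fun (@continuous_cos R).
exact: measurableT_comp mc md.
Qed.

Lemma measurable_cos_gauss n (H : 'M[R]_n) (u : 'rV[R]_n) c t :
  measurable_fun setT
    (fun x => ((1 + c * cos (dotv u x + t)) * expR (- (qform H x / 2)))%:E).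
Proof.
apply/measurable_EFinP; apply: measurable_funM; last exact: measurable_gauss.
apply: measurable_funD => //; apply: measurable_funM => //.
exact: measurable_cos_dotv.
Qed.

(** Writing the frequency as v H keeps the inverse of H out of the induction. The amplitude c must
    be a parameter: integrating the first coordinate replaces it by c e^(-q^2/(2h)), which is still
    at most 1 in absolute value. Taking c = 0 gives the mass and c = 1 the Fourier transform.
    Positivity of the determinant is proved along the way, since each pivot is positive. *)
Lemma gauss_cos_integral n (H : 'M[R]_n) : H^T = H ->
    (forall t, t != 0 -> 0 < qform H t) ->
  0 < \det H /\ forall (v : 'rV[R]_n) (c t : R), `|c| <= 1 ->
  (\int[@lebesgue_rV R n]_x
     ((1 + c * cos (dotv (v *m H) x + t)) * expR (- (qform H x / 2)))%:E =
   (Num.sqrt ((2 * pi) ^+ n / \det H) *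
     (1 + c * expR (- (qform H v / 2)) * cos t))%:E)%E.
Proof.
elim: n H => [|n IHn] H Hs Hp.
  rewrite det_mx00; split => // v c t c1.
  rewrite integral_rV0; last exact: measurable_cos_gauss.
  rewrite /qform /dotv !big_ord0 expr0 divr1 sqrtr1 mul1r mul0r oppr0 expR0.
  by rewrite !mulr1 add0r.
have h0 := schur_pivot_gt0 Hs Hp; have hN0 : H 0 0 != 0 by rewrite gt_eqF.
have [dS IH] := IHn _ (schur_sym Hs) (schur_gt0 Hs Hp).
have dH := det_schur Hs hN0.
split => [|v c t c1]; first by rewrite dH mulr_gt0.
set h := H 0 0 in h0 hN0 dH *.
pose b : 'rV[R]_n := ursubmx (H : 'M[R]_(1 + n, 1 + n)).
rewrite -(rV_unconsK v); case: (rV_uncons v) => v0 v' {v}.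
pose q := h * v0 + dotv b v'.
pose c' := c * gaussd h^-1 q.
have c'1 : `|c'| <= 1.
  rewrite /c' normrM mulr_ile1//.
  rewrite ger0_norm ?gaussd_ge0// /gaussd -[leRHS]expR0 ler_expR oppr_le0.
  by rewrite divr_ge0// mulr_ge0 ?sqr_ge0// invr_ge0 ltW.
rewrite ge0_integral_rVS2; last 2 first.
- exact: measurable_cos_gauss.
- move=> x; rewrite lee_fin mulr_ge0 ?expR_ge0//.
  suff : `|c * cos (dotv (rV_cons (v0, v') *m H) x + t)| <= 1 by rewrite ler_norml; lra.
  by rewrite normrM mulr_ile1// cos_max.
transitivity (\int[@lebesgue_rV R n]_x ((Num.sqrt (2 * pi / h))%:E *
    ((1 + c' * cos (dotv (v' *m schur H) x + t)) *
     expR (- (qform (schur H) x / 2)))%:E))%E.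
  apply: eq_integral => x _.
  pose s := h^-1 * dotv b x.
  pose t' := q * s + dotv (v' *m schur H) x + t.
  transitivity (\int[mu]_y (((1 + c * cos (q * y + t')) * gaussd h (y + s))%:E *
      (expR (- (qform (schur H) x / 2)))%:E))%E.
    apply: eq_integral => y _; rewrite -EFinM -mulrA.
    rewrite (dotv_schur Hs)// (qform_schur Hs)// -/h -/b -/q -/s.
    congr ((1 + c * cos _) * _)%:E; first by rewrite /t'; ring.
    rewrite /gaussd -expRD; congr expR; ring.
  rewrite ge0_integralZr//; last 2 first.
  - apply/measurable_EFinP; apply: continuous_measurable_fun => y.
    apply: cvgM; last first.
      apply: continuous_comp; last exact: continuous_gaussd.
      by apply: cvgD; [exact: cvg_id|exact: cvg_cst].
    apply: cvgD; first exact: cvg_cst.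
    apply: cvgMl_tmp; apply: continuous_comp; last exact: continuous_cos.
    by apply: cvgD; [apply: cvgMl_tmp; exact: cvg_id|exact: cvg_cst].
  - move=> y _; rewrite lee_fin mulr_ge0 ?gaussd_ge0//.
    suff : `|c * cos (q * y + t')| <= 1 by rewrite ler_norml; lra.
    by rewrite normrM mulr_ile1// cos_max.
  rewrite ge0_integral_cos_gaussd// -!EFinM; congr EFin.
  have -> : t' - q * s = dotv (v' *m schur H) x + t by rewrite /t'; ring.
  by rewrite [RHS]mulrA.
rewrite ge0_integralZl//; last 2 first.
- exact: measurable_cos_gauss.
- move=> x _; rewrite lee_fin mulr_ge0 ?expR_ge0//.
  suff : `|c' * cos (dotv (v' *m schur H) x + t)| <= 1 by rewrite ler_norml; lra.
  by rewrite normrM mulr_ile1// cos_max.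
rewrite IH// -EFinM mulrA; congr EFin; congr (_ * (1 + _ * _)).
  rewrite -sqrtrM ?divr_ge0 ?mulr_ge0 ?pi_ge0 ?ltW//; congr Num.sqrt.
  by rewrite dH exprS; field; rewrite hN0 gt_eqF.
rewrite /c' -mulrA; congr (_ * _); rewrite /gaussd -expRD (qform_schur Hs)//.
by congr expR; rewrite -/h -/b /q; field.
Qed.

End gaussian_rV.

(** * Measures determined by the integrals of cosines *)

Section step_polynomial.
Variable R : realType.

(* Tends to the indicator of y > 0 pointwise on [-1, 1]: off 0 the first factor
   tends to 1, while the second one behaves like exp (- (1 - y)^m). The first
   factor serves only to give the value 0 at y = 0. *)
Definition step_poly (m : nat) (y : R) : R :=
  (1 - (1 - y ^+ 2) ^+ m) * (1 - ((1 - y) / 2) ^+ m) ^+ (2 ^ m).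

Lemma bernoulli_le (x : R) (m : nat) : 0 <= x <= 1 -> 1 - m%:R * x <= (1 - x) ^+ m.
Proof.
move=> /andP[x0 x1]; elim: m => [|m IH]; first by rewrite mul0r subr0 expr0.
have xm : (1 - x) ^+ m <= 1 by rewrite exprn_ile1 ?subr_ge0// lerBlDl lerDr.
rewrite exprS mulrBl mul1r -natr1.
have xx : x * (1 - x) ^+ m <= x by rewrite ler_piMr.
lra.
Qed.

(** An upper counterpart of Bernoulli's inequality; the induction step is (1 - x) (1 + (m + 1) x) <=
    1 + m x. *)
Lemma bernoulli_ge (x : R) (m : nat) : 0 <= x <= 1 ->
  (1 - x) ^+ m * (1 + m%:R * x) <= 1.
Proof.
move=> /andP[x0 x1]; elim: m => [|m IH]; first by rewrite mul0r addr0 expr0 mulr1.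
apply: le_trans IH; rewrite exprSr -mulrA ler_wpM2l ?exprn_ge0 ?subr_ge0//.
rewrite -natr1; have : 0 <= m%:R :> R by []; nra.
Qed.

Lemma sqr_le1 (y : R) : `|y| <= 1 -> 0 <= 1 - y ^+ 2 <= 1.
Proof. by rewrite ler_norml => /andP[y1 y2]; apply/andP; split; nra. Qed.

Lemma step_poly_itv (m : nat) (y : R) : `|y| <= 1 -> 0 <= step_poly m y <= 1.
Proof.
move=> y1; have y21 := sqr_le1 y1.
have yh : 0 <= (1 - y) / 2 <= 1 by move: y1; rewrite ler_norml; lra.
have h (x : R) k : 0 <= x <= 1 -> 0 <= 1 - x ^+ k <= 1.
  move=> /andP[x0 x1]; rewrite subr_ge0 exprn_ile1//= lerBlDl lerDr exprn_ge0//.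
have /andP[a0 a1] := h _ m y21.
have /andP[b0 b1] := h _ m yh.
by rewrite /step_poly mulr_ge0 ?exprn_ge0//= mulr_ile1 ?exprn_ge0 ?exprn_ile1.
Qed.

(** With u = ((1 - y) / 2)^m one has 2^m u = (1 - y)^m. For y > 0 the second factor is at least 1 -
    (1 - y)^m, which tends to 1; for y < 0 it is at most 1 / (1 + (1 - y)^m), which tends to 0.
    These are the two Bernoulli bounds with exponent 2^m. *)
Lemma cvg_step_poly (y : R) : `|y| <= 1 ->
  step_poly m y @[m --> \oo] --> ((0 < y)%R%:R : R).
Proof.
move=> y1; have e2 : 2 * ((1 - y) / 2) = 1 - y by field.
have [y0|y0|->] := ltgtP y 0; last first.
- apply: cvg_near_cst; near=> m.
  by rewrite /step_poly expr0n/= subr0 expr1n subrr mul0r.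
- have /andP[y2 _] := sqr_le1 y1.
  rewrite -[X in _ --> X](mulr1 1); apply: cvgM.
    rewrite -[X in _ --> X](subr0 1); apply: cvgB; first exact: cvg_cst.
    apply: cvg_expr; rewrite ger0_norm// ltrBlDl ltrDr.
    by rewrite exprn_gt0.
  apply: (@squeeze_cvgr _ _ _ _ (fun m : nat => 1 - (1 - y) ^+ m) (cst 1)); last 2 first.
  + rewrite -[X in _ --> X](subr0 1); apply: cvgB; first exact: cvg_cst.
    by apply: cvg_expr; move: y1; rewrite ltr_norml ler_norml; lra.
  + exact: cvg_cst.
  apply: nearW => m /=.
  have /andP[h0 h1] : 0 <= ((1 - y) / 2) ^+ m <= 1.
    have hh : 0 <= (1 - y) / 2 <= 1 by move: y1; rewrite ler_norml; lra.
    by case/andP: hh => *; rewrite exprn_ge0//= exprn_ile1.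
  apply/andP; split; last first.
    by rewrite exprn_ile1 ?subr_ge0// lerBlDl lerDr.
  apply: le_trans (bernoulli_le (2 ^ m) _); last by rewrite h0.
  by rewrite natrX -exprMn e2.
- apply: (@squeeze_cvgr _ _ _ _ (cst 0) (fun m : nat => (1 - y) ^- m)); last 2 first.
  + exact: cvg_cst.
  + under eq_fun do rewrite -exprVn.
    apply: cvg_expr; rewrite ger0_norm ?invr_ge0; last by lra.
    by rewrite invf_lt1; lra.
  apply: nearW => m /=.
  have /andP[-> /= _] := step_poly_itv m y1.
  have hh : 0 <= (1 - y) / 2 <= 1 by move: y1; rewrite ler_norml; lra.
  have /andP[h0 h1] : 0 <= ((1 - y) / 2) ^+ m <= 1.
    by case/andP: hh => *; rewrite exprn_ge0//= exprn_ile1.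
  have y21 : 0 <= 1 - (1 - y ^+ 2) ^+ m <= 1.
    by have := sqr_le1 y1 => /andP[x0 x1]; rewrite subr_ge0 exprn_ile1//= lerBlDl lerDr exprn_ge0.
  rewrite /step_poly; set q := (1 - _ ^+ m) ^+ _.
  have q0 : 0 <= q by rewrite exprn_ge0// subr_ge0.
  apply: (@le_trans _ _ q); first by rewrite ler_piMl//; case/andP: y21.
  have := bernoulli_ge (2 ^ m) (x := ((1 - y) / 2) ^+ m).
  rewrite h0 h1 => /(_ isT).
  rewrite natrX -exprMn e2.
  have ym : 0 < (1 - y) ^+ m by rewrite exprn_gt0//; lra.
  rewrite -[X in _ -> _ <= X]mul1r ler_pdivlMr//; apply: le_trans.
  by rewrite ler_wpM2l// lerDr.
Unshelve. all: end_near. Qed.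

End step_polynomial.

Section trigonometric_polynomials.
Variables (R : realType) (n : nat).
Implicit Types f g : 'rV[R]_n -> R.

(** Only linear combinations are constructors, so a linear functional is determined by its values on
    the cosines; closure under products is a theorem. *)
Inductive trigpoly : ('rV[R]_n -> R) -> Prop :=
| trig_cos u t : trigpoly (fun x => cos (dotv u x + t))
| trig_lin c f g : trigpoly f -> trigpoly g -> trigpoly (fun x => c * f x + g x).

Lemma trigpoly1 : trigpoly (fun=> 1).
Proof.
rewrite (_ : (fun=> 1) = (fun x => cos (dotv 0 x + 0))); first exact: trig_cos.
by apply/funext => x; rewrite dotv0l addr0 cos0.
Qed.

Lemma trigpoly0 : trigpoly (fun=> 0).
Proof.
rewrite (_ : (fun=> 0) = (fun x => -1 * 1 + 1)).
  exact: (trig_lin (-1) trigpoly1 trigpoly1).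
by apply/funext => x; rewrite mulN1r addNr.
Qed.

Lemma trigpolyZ c f : trigpoly f -> trigpoly (fun x => c * f x).
Proof.
move=> tf; have := trig_lin c tf trigpoly0.
by congr trigpoly; apply/funext => x; rewrite addr0.
Qed.

Lemma trigpolyD f g : trigpoly f -> trigpoly g -> trigpoly (fun x => f x + g x).
Proof.
move=> tf tg; have := trig_lin 1 tf tg.
by congr trigpoly; apply/funext => x; rewrite mul1r.
Qed.

(** Bilinearity reduces to two cosines, whose product is half the sum of the cosines of the sum and
    of the difference of the arguments. *)
Lemma trigpolyM f g : trigpoly f -> trigpoly g -> trigpoly (fun x => f x * g x).
Proof.
elim => [u t|c f1 f2 _ IH1 _ IH2] tg; last first.
  have := trig_lin c (IH1 tg) (IH2 tg).
  by congr trigpoly; apply/funext => x; rewrite mulrDl mulrA.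
elim: tg => [v s|c g1 g2 _ IH1 _ IH2]; last first.
  have := trig_lin c IH1 IH2.
  by congr trigpoly; apply/funext => x; rewrite mulrDr mulrCA.
have := trigpolyD (trigpolyZ (1/2) (trig_cos (u + v) (t + s)))
                  (trigpolyZ (1/2) (trig_cos (u - v) (t - s))).
congr trigpoly; apply/funext => x.
have -> : dotv (u + v) x + (t + s) = (dotv u x + t) + (dotv v x + s).
  by rewrite dotvDl; ring.
have -> : dotv (u - v) x + (t - s) = (dotv u x + t) - (dotv v x + s).
  by rewrite dotvDl dotvNl; ring.
by rewrite cosD cosB; field.
Qed.

Lemma trigpolyX f m : trigpoly f -> trigpoly (fun x => f x ^+ m).
Proof.
move=> tf; elim: m => [|m IH].
  by rewrite (_ : (fun x => _) = (fun=> 1)); [exact: trigpoly1|apply/funext].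
rewrite (_ : (fun x => _) = (fun x => f x * f x ^+ m)); first exact: trigpolyM.
by apply/funext => x; rewrite exprS.
Qed.

Lemma trigpolyB f g : trigpoly f -> trigpoly g -> trigpoly (fun x => f x - g x).
Proof.
move=> tf tg; have := trig_lin (-1) tg tf.
by congr trigpoly; apply/funext => x; rewrite mulN1r addrC.
Qed.

Lemma trigpoly_step f m : trigpoly f -> trigpoly (fun x => step_poly m (f x)).
Proof.
move=> tf; apply: trigpolyM.
  by do 2 (apply: (trigpolyB trigpoly1); apply: trigpolyX).
apply: trigpolyX; apply: (trigpolyB trigpoly1); apply: trigpolyX.
have := trigpolyZ 2^-1 (trigpolyB trigpoly1 tf).
by congr trigpoly; apply/funext => x; rewrite mulrC.
Qed.

Lemma trigpoly_sin (c b : R) u : trigpoly (fun x => sin (c * (dotv u x - b))).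
Proof.
have := trig_cos (c *: u) (- (c * b) - pi / 2).
congr trigpoly; apply/funext => x.
by rewrite addrA cosBpihalf dotvZl mulrBr.
Qed.

Lemma trigpoly_measurable f : trigpoly f -> measurable_fun setT f.
Proof.
elim => [u t|c f1 f2 _ m1 _ m2]; first exact: measurable_cos_dotv.
by apply: measurable_funD => //; apply: measurable_funM.
Qed.

Lemma trigpoly_bounded f : trigpoly f -> exists M, forall x, `|f x| <= M.
Proof.
elim => [u t|c f1 f2 _ [M1 h1] _ [M2 h2]]; first by exists 1 => x; exact: cos_max.
exists (`|c| * M1 + M2) => x; rewrite (le_trans (ler_normD _ _))// lerD//.
by rewrite normrM ler_wpM2l.
Qed.

Lemma trigpoly_prod (I : Type) (s : seq I) (F : I -> 'rV[R]_n -> R) :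
  (forall i, trigpoly (F i)) -> trigpoly (fun x => \prod_(i <- s) F i x).
Proof.
move=> tF; elim: s => [|i s IH].
  rewrite (_ : (fun x => _) = (fun=> 1)); first exact: trigpoly1.
  by apply/funext => x; rewrite big_nil.
rewrite (_ : (fun x => _) = (fun x => F i x * \prod_(i <- s) F i x)).
  exact: trigpolyM.
by apply/funext => x; rewrite big_cons.
Qed.

End trigonometric_polynomials.

Section weighted_law.
Context d (T : measurableType d) (R : realType) (n : nat).
Variables (mu : {measure set T -> \bar R}) (X : T -> 'rV[R]_n) (g : T -> R).
Hypotheses (mX : measurable_fun setT X) (mg : measurable_fun setT g).
Hypotheses (g0 : forall x, 0 <= g x) (ig : mu.-integrable setT (EFin \o g)).

Implicit Types h : 'rV[R]_n -> R.

(** A common form for the two measures to be compared: the law of Y is the case g = 1, the Gaussian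
    density the case where X is the identity. *)
Definition wlaw (h : 'rV[R]_n -> R) : R := \int[mu]_x (h (X x) * g x).

Lemma measurable_wlaw h : measurable_fun setT h ->
  measurable_fun setT (fun x => h (X x) * g x).
Proof. by move=> mh; apply: measurable_funM => //; exact: measurableT_comp mh mX. Qed.

Lemma wlaw_integrable h M : measurable_fun setT h -> (forall x, `|h x| <= M) ->
  mu.-integrable setT (EFin \o (fun x => h (X x) * g x)).
Proof.
move=> mh hM.
apply: (@dominated_integrable _ _ _ mu setT _ (fun x => M * g x)) => //.
- exact: measurable_wlaw.
- by move=> x _; rewrite normrM (ger0_norm (g0 x)) ler_wpM2r.
- by have := integrableZl measurableT M ig; exact: eq_integrable.
Qed.

Lemma wlaw_trig_lin c h1 h2 : trigpoly h1 -> trigpoly h2 ->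
  wlaw (fun x => c * h1 x + h2 x) = c * wlaw h1 + wlaw h2.
Proof.
move=> t1 t2.
have [M1 b1] := trigpoly_bounded t1; have [M2 b2] := trigpoly_bounded t2.
have i1 := wlaw_integrable (trigpoly_measurable t1) b1.
have i2 := wlaw_integrable (trigpoly_measurable t2) b2.
rewrite /wlaw -RintegralZl// -RintegralD//; last first.
  by have := integrableZl measurableT c i1; exact: eq_integrable.
by apply: eq_Rintegral => x _; rewrite mulrDl mulrA.
Qed.

(** Dominated convergence with majorant g. Measurability of the limit belongs to the conclusion
    because the lemma is applied twice in a row, the second time to limits obtained from the
    first. *)
Lemma wlaw_cvg (h_ : nat -> 'rV[R]_n -> R) h :
  (forall k, measurable_fun setT (h_ k)) -> (forall k x, `|h_ k x| <= 1) ->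
  (forall x, h_ k x @[k --> \oo] --> h x) ->
  measurable_fun setT h /\ wlaw (h_ k) @[k --> \oo] --> wlaw h.
Proof.
move=> mh h1 hc.
have mh' : measurable_fun setT h by exact: (measurable_fun_cvg mh).
split => //.
have [ih _ cv] : [/\ mu.-integrable setT (EFin \o (fun x => h (X x) * g x)),
    (\int[mu]_x `|(h_ k (X x) * g x)%:E - (h (X x) * g x)%:E|)%E @[k --> \oo] --> 0%E &
    (\int[mu]_x (h_ k (X x) * g x)%:E)%E @[k --> \oo] -->
      (\int[mu]_x (h (X x) * g x)%:E)%E].
  apply: (@dominated_convergence _ _ _ mu setT _ (fun k x => (h_ k (X x) * g x)%:E)
    (EFin \o (fun x => h (X x) * g x)) (EFin \o g)) => //.
  - by move=> k; apply/measurable_EFinP; exact: measurable_wlaw.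
  - by apply/measurable_EFinP; exact: measurable_wlaw.
  - apply: aeW => x _; apply: cvg_EFin; first exact: nearW.
    by apply: cvgMr_tmp; exact: hc.
  - apply: aeW => x k _; rewrite /= lee_fin normrM (ger0_norm (g0 x)).
    by rewrite ler_piMl.
by apply: fine_cvg; rewrite /Rintegral fineK//; exact: integrable_fin_num.
Qed.

Lemma wlaw_indic (A : set 'rV[R]_n) : measurable A ->
  (\int[mu]_(x in X @^-1` A) (g x)%:E)%E = (wlaw (\1_A))%:E.
Proof.
move=> mA.
have i1 : mu.-integrable setT (EFin \o (fun x => \1_A (X x) * g x)).
  apply: (@wlaw_integrable _ 1) => [|x]; first exact: measurable_indic.
  by rewrite indicE; case: (_ \in _); rewrite ?normr1 ?normr0.
rewrite /wlaw /Rintegral fineK; last exact: integrable_fin_num.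
rewrite integral_mkcond; apply: eq_integral => x _.
rewrite patchE indicE; have [Ax|Ax] := boolP (X x \in A).
  by rewrite mem_set ?mul1r//; move: Ax; rewrite inE.
by rewrite memNset ?mul0r//; move: Ax; rewrite notin_setE.
Qed.

End weighted_law.

(** * Half-spaces as generators of the Borel sets and as limits of trigonometric polynomials *)

Section half_spaces.
Variables (R : realType) (n : nat).

(** With lists, intersection is concatenation and the empty list gives the whole space, so the range
    of [half_spaces] is a pi-system. *)
Definition half_spaces (s : seq ('rV[R]_n * R)) : set 'rV[R]_n :=
  [set x | all (fun p => p.2 < dotv p.1 x) s].

Lemma half_spaces_cat s1 s2 :
  half_spaces (s1 ++ s2) = half_spaces s1 `&` half_spaces s2.
Proof.
by apply/seteqP; split => x; rewrite /half_spaces/= all_cat => /andP.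
Qed.

Lemma measurable_half_spaces s : measurable (half_spaces s).
Proof.
elim: s => [|p s IH].
  by rewrite (_ : half_spaces _ = setT)//; apply/seteqP; split.
rewrite -cat1s half_spaces_cat; apply: measurableI => //.
have := @measurable_dotv R n p.1 measurableT _ (measurable_itv `]p.2, +oo[).
rewrite setTI; congr measurable; apply/seteqP; split => x;
  by rewrite /half_spaces /= in_itv/= !andbT.
Qed.

Lemma dotv_delta i (x : 'rV[R]_n) : dotv (delta_mx 0 i) x = x 0 i.
Proof.
rewrite /dotv (bigD1 i)//= big1 ?addr0 => [|j ji].
  by rewrite mxE !eqxx mul1r.
by rewrite mxE (negbTE ji) andbF mul0r.
Qed.

(** These balls are those of the sup norm, that is open boxes cut out by 2 n half-spaces. Every open
    set is a countable union of such balls with rational centers. *)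
Lemma ball_half_spaces (c : 'rV[R]_n) (e : R) : 0 < e ->
  ball c e = half_spaces
    ([seq (delta_mx 0 i, c 0 i - e) | i <- enum 'I_n] ++
     [seq (- delta_mx 0 i, - (c 0 i + e)) | i <- enum 'I_n]).
Proof.
move=> e0; apply/seteqP; split => x.
  move=> [_ cx]; rewrite /half_spaces/= all_cat !all_map.
  apply/andP; split; apply/allP => i _ /=; have := cx 0 i; rewrite /ball/= ltr_norml.
    by rewrite dotv_delta; lra.
  by rewrite dotvNl dotv_delta; lra.
rewrite /half_spaces/= all_cat !all_map => /andP[/allP h1 /allP h2].
split => // i j; rewrite ord1 /ball/= ltr_norml.
have je : j \in Finite.enum 'I_n by rewrite -enumT mem_enum.
have := h1 j je; have := h2 j je.
by rewrite /= dotvNl dotv_delta; lra.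
Qed.

Lemma measurable_rV_half_spaces :
  @measurable _ 'rV[R]_n = <<s range half_spaces >>.
Proof.
apply/seteqP; split; last first.
  apply: smallest_sub; first exact: sigma_algebra_measurable.
  by move=> _ [s _ <-]; exact: measurable_half_spaces.
rewrite mx_measurableE; apply: smallest_sub; first exact: smallest_sigma_algebra.
move=> A /open_mx_bigcup ->.
suff : measurable (\bigcup_(q in [set q : 'M[rat]_(1, n) * nat |
        ball (map_mx ratr q.1 : 'M[R]_(1, n)) q.2.+1%:R^-1 `<=` A])
      ball (map_mx ratr q.1 : 'M[R]_(1, n)) q.2.+1%:R^-1
      : set (g_sigma_algebraType (range half_spaces))) by [].
rewrite bigcup_mkcond; apply: countable_bigcupT_measurable => // q.
case: ifPn => _ //.
rewrite ball_half_spaces; last by rewrite invr_gt0.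
by apply: sub_sigma_algebra; eexists.
Qed.

(** Two successive limits are needed. Step polynomials converge on [-1, 1] only, so the linear form
    is first passed through a sine; for fixed L the limit in m is then a periodic pattern of signs,
    and L -> oo pushes the wrong signs off to infinity. *)
Lemma trigpoly_approx_half_spaces (s : seq ('rV[R]_n * R)) :
  exists P : nat -> nat -> 'rV[R]_n -> R, exists Q : nat -> 'rV[R]_n -> R,
  [/\ forall L m, trigpoly (P L m), forall L m x, 0 <= P L m x <= 1,
      forall L x, P L m x @[m --> \oo] --> Q L x &
      forall x, Q L x @[L --> \oo] --> (\1_(half_spaces s) x : R)].
Proof.
pose y L (p : 'rV[R]_n * R) x := sin (L.+1%:R^-1 * (dotv p.1 x - p.2)).
(* The sign of sin (z / L) is eventually that of z. *)
exists (fun L m x => \prod_(p <- s) step_poly m (y L p x)).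
exists (fun L x => \prod_(p <- s) ((0 < y L p x)%R%:R : R)).
have y1 L p x : `|y L p x| <= 1 by exact: sin_max.
split => [L m|L m x|L x|x].
- apply: trigpoly_prod => p; apply: trigpoly_step; exact: trigpoly_sin.
- elim: s => [|p s /andP[IH0 IH1]]; first by rewrite big_nil ler01 lexx.
  have /andP[h0 h1] := step_poly_itv m (y1 L p x).
  by rewrite big_cons mulr_ge0//= mulr_ile1.
- elim: s => [|p s IH].
    by under eq_fun do rewrite big_nil; rewrite big_nil; exact: cvg_cst.
  under eq_fun do rewrite big_cons.
  by rewrite big_cons; apply: cvgM IH; exact: cvg_step_poly.
- elim: s => [|p s IH].
    under eq_fun do rewrite big_nil.
    by rewrite indicE mem_set//; exact: cvg_cst.
  under eq_fun do rewrite big_cons.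
  have -> : \1_(half_spaces (p :: s)) x = ((p.2 < dotv p.1 x)%R%:R : R) * \1_(half_spaces s) x.
    rewrite -cat1s half_spaces_cat indicI/=; congr (_ * _).
    rewrite indicE; congr (nat_of_bool _)%:R.
    by apply/idP/idP; rewrite inE /half_spaces/= andbT.
  apply: cvgM IH; apply: cvg_near_cst.
  pose z := dotv p.1 x - p.2.
  near=> L; congr (nat_of_bool _)%:R; rewrite /y -/z -[RHS]subr_gt0 -/z.
  have L0 : 0 < L.+1%:R^-1 :> R by rewrite invr_gt0.
  have zL : `|z| < L.+1%:R * pi.
    rewrite -ltr_pdivrMr ?pi_gt0//.
    apply: (@lt_trans _ _ L%:R); last by rewrite ltr_nat.
    by near: L; exact: nbhs_infty_gtr.
  have zpi : `|L.+1%:R^-1 * z| < pi.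
    by rewrite normrM gtr0_norm// mulrC ltr_pdivrMr// mulrC.
  have [z0|z0|z0] := ltgtP z 0.
  + apply/negbTE; rewrite -leNgt -oppr_ge0 -sinN.
    apply: ltW; apply: sin_gt0_pi; rewrite -mulrN mulr_gt0 ?oppr_gt0//=.
    by rewrite mulrN (le_lt_trans _ zpi)// -normrN ler_norm.
  + by apply: sin_gt0_pi; rewrite mulr_gt0//= (le_lt_trans _ zpi)// ler_norm.
  + by rewrite z0 mulr0 sin0 ltxx.
Unshelve. all: end_near. Qed.

End half_spaces.

Lemma wlaw_half_spaces d1 (T1 : measurableType d1) d2 (T2 : measurableType d2)
    (R : realType) (n : nat)
    (m1 : {measure set T1 -> \bar R}) (X1 : T1 -> 'rV[R]_n) (g1 : T1 -> R)
    (m2 : {measure set T2 -> \bar R}) (X2 : T2 -> 'rV[R]_n) (g2 : T2 -> R) :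
  measurable_fun setT X1 -> measurable_fun setT g1 -> (forall x, 0 <= g1 x) ->
  m1.-integrable setT (EFin \o g1) ->
  measurable_fun setT X2 -> measurable_fun setT g2 -> (forall x, 0 <= g2 x) ->
  m2.-integrable setT (EFin \o g2) ->
  (forall u t, wlaw m1 X1 g1 (fun x => cos (dotv u x + t)) =
               wlaw m2 X2 g2 (fun x => cos (dotv u x + t))) ->
  forall s, wlaw m1 X1 g1 (\1_(half_spaces s)) = wlaw m2 X2 g2 (\1_(half_spaces s)).
Proof.
move=> mX1 mg1 g10 ig1 mX2 mg2 g20 ig2 E s.
have Et f : trigpoly f -> wlaw m1 X1 g1 f = wlaw m2 X2 g2 f.
  elim => [u t|c f1 f2 t1 e1 t2 e2]; first exact: E.
  by rewrite !wlaw_trig_lin// e1 e2.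
have [P [Q [tP bP PQ Qs]]] := trigpoly_approx_half_spaces s.
have mP L m := trigpoly_measurable (tP L m).
have nP L m x : `|P L m x| <= 1.
  by have /andP[h0 h1] := bP L m x; rewrite ger0_norm.
have nQ L x : `|Q L x| <= 1.
  by apply: (cvgr_to_le (cvg_norm (PQ L x))); exact: nearW.
have EQ L : measurable_fun setT (Q L) /\ wlaw m1 X1 g1 (Q L) = wlaw m2 X2 g2 (Q L).
  have [mQ c1] := wlaw_cvg mX1 mg1 g10 ig1 (mP L) (nP L) (PQ L).
  have [_ c2] := wlaw_cvg mX2 mg2 g20 ig2 (mP L) (nP L) (PQ L).
  have e : (fun m => wlaw m1 X1 g1 (P L m)) = (fun m => wlaw m2 X2 g2 (P L m)).
    by apply/funext => m; exact: Et.
  by split => //; rewrite e in c1; exact: (cvg_unique _ c1 c2).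
have mQ L := (EQ L).1.
have [_ c1] := wlaw_cvg mX1 mg1 g10 ig1 mQ nQ Qs.
have [_ c2] := wlaw_cvg mX2 mg2 g20 ig2 mQ nQ Qs.
have e : (fun L => wlaw m1 X1 g1 (Q L)) = (fun L => wlaw m2 X2 g2 (Q L)).
  by apply/funext => L; exact: (EQ L).2.
by rewrite e in c1; exact: (cvg_unique _ c1 c2).
Qed.

(** * Gaussian vectors *)

Section density.
Context d (T : measurableType d) (R : realType).
Variables (mu : {measure set T -> \bar R}) (g : T -> R).
Hypotheses (mg : measurable_fun setT g) (g0 : forall x, 0 <= g x).

(** The two proofs are arguments so that the measure structure declared below, which depends on
    them, can be attached to this function. *)
Definition density_measure (_ : measurable_fun setT g) (_ : forall x, 0 <= g x)
    (A : set T) : \bar R :=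
  (\int[mu]_(x in A) (g x)%:E)%E.

Let density0 : density_measure mg g0 set0 = 0%E.
Proof. by rewrite /density_measure integral_set0. Qed.

Let density_ge0 A : (0 <= density_measure mg g0 A)%E.
Proof. by apply: integral_ge0 => x _; rewrite lee_fin. Qed.

Let density_sigma_additive : semi_sigma_additive (density_measure mg g0).
Proof.
move=> F mF tF mUF; rewrite /density_measure; apply: cvg_toP.
  apply: ereal_nondecreasing_is_cvgn => m n mn.
  apply: lee_sum_nneg_natr => // k _ _.
  by apply: integral_ge0 => x _; rewrite lee_fin.
rewrite ge0_integral_bigcup//=.
- by apply: measurable_funTS; apply/measurable_EFinP.
- by move=> x _; rewrite lee_fin.
Qed.

HB.instance Definition _ := isMeasure.Build _ _ _ (density_measure mg g0)
  density0 density_ge0 density_sigma_additive.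

Import HBNNSimple.

Lemma integral_density_indic (nu : {measure set T -> \bar R}) (A : set T) (r : R) :
  (forall A, measurable A -> nu A = \int[mu]_(x in A) (g x)%:E)%E ->
  measurable A -> 0 <= r ->
  (\int[nu]_x (r * \1_A x)%:E = \int[mu]_x ((r * \1_A x)%:E * (g x)%:E))%E.
Proof.
move=> nuE mA r0.
have m1 : measurable_fun setT (fun x => (\1_A x)%:E : \bar R).
  exact/measurable_EFinP/measurable_indic.
under eq_integral do rewrite EFinM.
rewrite ge0_integralZl//.
rewrite integral_indic// setIT nuE//.
under [RHS]eq_integral do rewrite EFinM -muleA.
rewrite ge0_integralZl//; last 2 first.
- by apply: emeasurable_funM => //; apply/measurable_EFinP.
- by move=> x _; rewrite -EFinM lee_fin mulr_ge0.
congr (_ * _)%E; rewrite integral_mkcond; apply: eq_integral => x _.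
by rewrite patchE indicE; case: (x \in A); rewrite ?mul1e ?mul0e.
Qed.

Lemma ge0_integral_density (nu : {measure set T -> \bar R}) (f : T -> \bar R) :
  (forall A, measurable A -> nu A = \int[mu]_(x in A) (g x)%:E)%E ->
  measurable_fun setT f -> (forall x, 0 <= f x)%E ->
  (\int[nu]_x f x = \int[mu]_x (f x * (g x)%:E))%E.
Proof.
move=> nuE mf f0.
pose f_ := nnsfun_approx measurableT mf.
have f_f x : (EFin \o f_^~ x) n @[n --> \oo] --> f x.
  by apply: cvg_nnsfun_approx => // y _; exact: f0.
have step (h : {nnsfun T >-> R}) :
    (\int[nu]_x (h x)%:E = \int[mu]_x ((h x)%:E * (g x)%:E))%E.
  (* On the range of the nonnegative [h] the absolute value changes nothing; it makes the summand
     nonnegative for every real r, as the exchange of sum and integral asks. *)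
  have hE x : (h x)%:E = (\sum_(r \in range h)
      (`|r| * \1_(h @^-1` [set r]) x)%:E)%E.
    rewrite fsumEFin//; congr EFin; rewrite [LHS]fimfunE; apply: eq_fsbigr => r.
    by rewrite inE => -[y _ <-]; rewrite ger0_norm.
  have mh r : measurable_fun setT (fun x => (`|r| * \1_(h @^-1` [set r]) x)%:E).
    by apply/measurable_EFinP/measurable_funM.
  have h0 r x : (0 <= (`|r| * \1_(h @^-1` [set r]) x)%:E)%E.
    by rewrite lee_fin mulr_ge0.
  under eq_integral do rewrite hE.
  rewrite ge0_integral_fsum//.
  under [RHS]eq_integral do rewrite hE ge0_mule_fsuml//.
  rewrite [RHS]ge0_integral_fsum//; last 2 first.
  - by move=> r; apply: emeasurable_funM => //; apply/measurable_EFinP.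
  - by move=> r x _; apply: mule_ge0; rewrite ?lee_fin.
  apply: eq_fsbigr => r _; exact: integral_density_indic.
transitivity (limn (fun n => \int[nu]_x (f_ n x)%:E)%E).
  rewrite -monotone_convergence//.
  - by apply: eq_integral => x _; apply/esym/cvg_lim => //; exact: f_f.
  - by move=> n; exact/measurable_EFinP.
  - by move=> n x _; rewrite lee_fin.
  - by move=> x _ m n mn; rewrite lee_fin; exact/lefP/nd_nnsfun_approx.
under eq_fun do rewrite step.
rewrite -monotone_convergence//.
- apply: eq_integral => x _; apply/cvg_lim => //.
  by apply: cvgeZr => //; exact: f_f.
- by move=> n; apply: emeasurable_funM; exact/measurable_EFinP.
- by move=> n x _; rewrite mule_ge0 ?lee_fin.
- move=> x _ m n mn; rewrite lee_wpmul2r ?lee_fin//.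
  exact/lefP/nd_nnsfun_approx.
Qed.

End density.

Section normal_standardization.
Variable R : realType.
Notation mu := (@lebesgue_measure R).
Local Open Scope ereal_scope.

(** Substitution x = |s| y + m; s may be negative since the density depends on s^2 only. *)
Lemma ge0_integral_normal (m s : R) (f : R -> \bar R) : s != 0%R ->
  measurable_fun setT f -> (forall x, 0 <= f x) ->
  \int[normal_prob m s]_x f x =
  ((Num.sqrt (2 * pi))^-1)%:E *
    \int[mu]_y (f (`|s| * y + m)%R * (gaussd 1 y)%:E).
Proof.
move=> s0 mf f0.
have mpdf := @measurable_normal_pdf R m s.
have pdf0 := @normal_pdf_ge0 R m s.
rewrite (ge0_integral_density (mu := mu) (g := normal_pdf m s))//.
have as0 : (0 < `|s|)%R by rewrite normr_gt0.
pose F x := f x * (normal_pdf m s x)%:E.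
have mF : measurable_fun setT F.
  by apply: emeasurable_funM => //; exact/measurable_EFinP.
have F0 x : 0 <= F x by rewrite mule_ge0 ?lee_fin.
have -> : \int[mu]_x F x = `|s|%:E * \int[mu]_y F (`|s| * y + m)%R.
  by rewrite ge0_integral_affine// muleA -EFinM mulfV ?mul1e// gt_eqF.
have pdfE y : normal_pdf m s (`|s| * y + m)%R =
    ((Num.sqrt (2 * pi))^-1 * `|s|^-1 * gaussd 1 y)%R.
  rewrite normal_pdfE// /normal_fun /gaussd; congr (_ * expR _)%R.
    rewrite /normal_peak -invfM; congr (_^-1)%R.
    rewrite -mulrnAr sqrtrM ?sqr_ge0// sqrtr_sqr mulrC -mulr_natl.
    by [].
  rewrite addrK exprMn real_normK ?num_real//.
  by field; rewrite s0.
under eq_integral do rewrite /F pdfE EFinM muleCA.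
rewrite ge0_integralZl//; last 2 first.
- apply: emeasurable_funM; last by apply/measurable_EFinP; exact: measurable_gaussd.
  by apply: measurableT_comp => //; apply: measurable_funD => //.
- by move=> y _; rewrite mule_ge0 ?lee_fin ?gaussd_ge0.
rewrite muleA -EFinM; congr (_%:E * _).
by rewrite mulrCA mulfV ?mulr1// gt_eqF.
Qed.

End normal_standardization.

Section gaussian_law.
Context d (O : measurableType d) (R : realType) (Pr : probability O R).
Notation mu := (@lebesgue_measure R).

(* s = 0 is the Dirac law at m. *)
Definition gaussian_rv (Z : O -> R) (m s : R) :=
  measurable_fun setT Z /\ forall f : R -> \bar R, measurable_fun setT f ->
    (forall x, 0 <= f x)%E ->
    (\int[Pr]_w f (Z w) = ((Num.sqrt (2 * pi))^-1)%:E *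
      \int[mu]_y (f (s * y + m)%R * (gaussd 1 y)%:E))%E.

Lemma gaussian_vector_dotv k (Y : {RV Pr >-> 'rV[R]_k}) (u : 'rV[R]_k) :
  gaussian_vector Y ->
  exists m s : R, 0 <= s /\ gaussian_rv (fun w => dotv u (Y w)) m s.
Proof.
move=> /(_ u)[m [sigma law]].
have mZ : measurable_fun setT (fun w => dotv u (Y w)).
  exact: measurableT_comp (measurable_dotv u) _.
exists m, `|sigma|; split => //; split => // f mf f0.
pose Z := (fun w => dotv u (Y w) : measurableTypeR R).
pose nu' : {measure set (measurableTypeR R) -> \bar R} := pushforward Pr Z.
pose nu := nu' mZ.
transitivity (\int[nu]_x f x)%E.
  by rewrite /nu /nu' ge0_integral_pushforward// preimage_setT.
have [s0|s0] := eqVneq sigma 0.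
  transitivity (\int[@dirac _ (measurableTypeR R) m R]_x f x)%E.
    apply: eq_measure_integral => A mA _.
    by have := law A mA; rewrite s0 eqxx.
  rewrite integral_dirac// diracT mul1e s0 normr0.
  under [in RHS]eq_integral do rewrite mul0r add0r.
  rewrite ge0_integralZl//; last 2 first.
  - by apply/measurable_EFinP; exact: measurable_gaussd.
  - by move=> y _; rewrite lee_fin gaussd_ge0.
  rewrite integral_gaussd// divr1 muleCA -EFinM mulVf ?mule1//.
  by rewrite gt_eqF// sqrtr_gt0 mulr_gt0// pi_gt0.
transitivity (\int[normal_prob m sigma]_x f x)%E.
  apply: eq_measure_integral => A mA _.
  by have := law A mA; rewrite (negbTE s0).
by rewrite ge0_integral_normal.
Qed.

Lemma sqrt2pi_gt0 : 0 < Num.sqrt (2 * pi) :> R.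
Proof. by rewrite sqrtr_gt0 mulr_gt0// pi_gt0. Qed.

(** Since [gaussian_rv] speaks of nonnegative functions, the mean is recovered from squares: the
    values at c = 1 and c = 0 differ by 2 m + 1. *)
Lemma gaussian_rv_sqr (Z : O -> R) (m s c : R) : gaussian_rv Z m s ->
  (\int[Pr]_w ((Z w + c) ^+ 2)%:E = (s ^+ 2 + (m + c) ^+ 2)%:E)%E.
Proof.
move=> [mZ law].
rewrite (law (fun x => ((x + c) ^+ 2)%:E)); last 2 first.
- by apply/measurable_EFinP; apply: measurable_funX; exact: measurable_funD.
- by move=> x; rewrite lee_fin sqr_ge0.
have i0 := @integrable_gaussd R 1 ltr01.
have i2 := integrable_sqr_gaussd R.
have i1 : mu.-integrable setT (EFin \o (fun y : R => y * gaussd 1 y)).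
  apply: (@integrable_le_gaussd _ _ 1 (1/2)) => //.
    by move=> x; apply: cvgM; [exact: cvg_id|exact: continuous_gaussd].
  by move=> x; rewrite normrM mul1r (ger0_norm (gaussd_ge0 _ _)) le_norm_gaussd.
have j2 : mu.-integrable setT (EFin \o (fun y => s ^+ 2 * (y ^+ 2 * gaussd 1 y))).
  by have := integrableZl measurableT (s ^+ 2) i2; exact: eq_integrable.
have j1 : mu.-integrable setT (EFin \o (fun y => (2 * s * (m + c)) * (y * gaussd 1 y))).
  by have := integrableZl measurableT (2 * s * (m + c)) i1; exact: eq_integrable.
have j0 : mu.-integrable setT (EFin \o (fun y => (m + c) ^+ 2 * gaussd 1 y)).
  by have := integrableZl measurableT ((m + c) ^+ 2) i0; exact: eq_integrable.
have j21 : mu.-integrable setT (EFin \o (fun y => s ^+ 2 * (y ^+ 2 * gaussd 1 y) +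
    (2 * s * (m + c)) * (y * gaussd 1 y))).
  by have := integrableD measurableT j2 j1; exact: eq_integrable.
have j : mu.-integrable setT (EFin \o (fun y => s ^+ 2 * (y ^+ 2 * gaussd 1 y) +
    (2 * s * (m + c)) * (y * gaussd 1 y) + (m + c) ^+ 2 * gaussd 1 y)).
  by have := integrableD measurableT j21 j0; exact: eq_integrable.
transitivity (((Num.sqrt (2 * pi))^-1)%:E *
    (\int[mu]_y (s ^+ 2 * (y ^+ 2 * gaussd 1 y) +
    (2 * s * (m + c)) * (y * gaussd 1 y) + (m + c) ^+ 2 * gaussd 1 y)%R)%:E)%E.
  congr (_ * _)%E; rewrite /Rintegral fineK; last exact: integrable_fin_num.
  by apply: eq_integral => y _; rewrite -EFinM; congr EFin; ring.
rewrite RintegralD// RintegralD// !RintegralZl//.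
rewrite moment2_gaussd moment1_gaussd integral_gaussd1 -EFinM; congr EFin.
by field; rewrite gt_eqF// sqrt2pi_gt0.
Qed.

Lemma gaussian_rv_cos (Z : O -> R) (s t : R) : gaussian_rv Z 0 s ->
  (\int[Pr]_w (1 + cos (Z w + t))%:E = (1 + expR (- (s ^+ 2 / 2)) * cos t)%:E)%E.
Proof.
move=> [mZ law].
have cc (x : R) : 0 <= 1 + cos (x + t) by have := cos_geN1 (x + t); lra.
rewrite (law (fun x => (1 + cos (x + t))%:E)); last 2 first.
- apply/measurable_EFinP; apply: measurable_funD => //.
  apply: (measurableT_comp (f := @cos R)).
    exact: continuous_measurable_fun (@continuous_cos R).
  exact: measurable_funD.
- by move=> x; rewrite lee_fin.
have := @ge0_integral_cos_gaussd R 1 0 s 1 t ltr01.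
rewrite normr1 lexx => /(_ isT) => E.
have -> : (\int[mu]_y ((1 + cos (s * y + 0 + t))%:E * (gaussd 1 y)%:E) =
    \int[mu]_y ((1 + 1 * cos (s * y + t)) * gaussd 1 (y + 0))%:E)%E.
  by apply: eq_integral => y _; rewrite !addr0 mul1r -EFinM.
rewrite E -EFinM; congr EFin.
rewrite divr1 mulr0 subr0 invr1 mulrA mulVf ?mul1r; last first.
  by rewrite gt_eqF// sqrt2pi_gt0.
by rewrite /gaussd mul1r.
Qed.

(** The Gaussian density is even, so the nonnegative half-line carries half of its mass;
    multiplication by s > 0 preserves that half-line. *)
Lemma gaussian_rv_ge0 (Z : O -> R) (s : R) : 0 < s -> gaussian_rv Z 0 s ->
  Pr [set w | 0 <= Z w] = (1 / 2)%:E.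
Proof.
move=> s0 [mZ law].
have mA : measurable [set x : R | 0 <= x] by rewrite -set_itvcy.
have mPA : measurable [set w | 0 <= Z w].
  by rewrite -[X in measurable X]setTI; exact: (mZ measurableT _ mA).
transitivity (\int[Pr]_w (\1_[set x : R | 0 <= x] (Z w))%:E)%E.
  transitivity (\int[Pr]_w (\1_[set w | 0 <= Z w] w)%:E)%E.
    by rewrite integral_indic// setIT.
  by apply: eq_integral => w _; rewrite !indicE.
rewrite (law (fun x => (\1_[set x : R | 0 <= x] x)%:E)); last 2 first.
- exact/measurable_EFinP/measurable_indic.
- by move=> x; rewrite lee_fin.
have sym := ge0_symfun_integralT (@gaussd_ge0 R 1) (@continuous_gaussd R 1).
have /sym : gaussd 1 =1 gaussd 1 \o (-%R : R -> R).
  by move=> x; rewrite /comp gaussdN.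
rewrite integral_gaussd//.
have -> : (\int[mu]_(x in [set x | 0 <= x]%R) (gaussd 1 x)%:E =
    \int[mu]_y ((\1_[set x : R | (0 <= x)%R] (s * y + 0)%R)%:E * (gaussd 1 y)%:E))%E.
  rewrite integral_mkcond; apply: eq_integral => y _.
  rewrite patchE addr0 indicE.
  have -> : (s * y \in [set x : R | 0 <= x]) = (y \in [set x : R | 0 <= x]).
    by apply/idP/idP; rewrite !inE/= pmulr_rge0.
  by case: ifPn => _; rewrite ?mul1e ?mul0e.
set I := integral _ _ _; rewrite divr1 => /esym E.
have I0 : (0 <= I)%E.
  by apply: integral_ge0 => y _; rewrite mule_ge0 ?lee_fin ?gaussd_ge0.
have q0 := sqrt2pi_gt0; have q1 : Num.sqrt (2 * pi) != 0 :> R by rewrite gt_eqF.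
move: I0 E; case: I => [r _|_|//]; last by rewrite gt0_muley.
rewrite -!EFinM => -[E]; congr EFin.
by rewrite (_ : r = Num.sqrt (2 * pi) / 2); [field|rewrite -E; field].
Qed.

End gaussian_law.

Lemma Rintegral_sum d (T : measurableType d) (R : realType)
    (mu : {measure set T -> \bar R}) (I : Type) (s : seq I) (f : I -> T -> R) :
  (forall i, mu.-integrable setT (EFin \o f i)) ->
  mu.-integrable setT (EFin \o (fun x => \sum_(i <- s) f i x)) /\
  \int[mu]_x (\sum_(i <- s) f i x) = \sum_(i <- s) \int[mu]_x f i x.
Proof.
move=> fi; elim: s => [|i s [IH1 IH2]].
  rewrite big_nil; split.
    rewrite (_ : _ \o _ = cst 0%E); first exact: integrable0.
    by apply/funext => x /=; rewrite big_nil.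
  by under eq_Rintegral do rewrite big_nil; rewrite /Rintegral integral0.
split.
  have := integrableD measurableT (fi i) IH1; apply: eq_integrable => // x _ /=.
  by rewrite big_cons.
under eq_Rintegral do rewrite big_cons.
by rewrite RintegralD// IH2 big_cons.
Qed.

Lemma Rintegral_probability1 d (T : measurableType d) (R : realType)
  (P : probability T R) : \int[P]_x (1 : R) = 1.
Proof.
rewrite /Rintegral (_ : (\int[P]_x 1%:E)%E = 1%E)//.
rewrite integral_cst// mul1e; exact: probability_setT.
Qed.

(** * Mean and variance of the projections of a centered Gaussian vector *)

Section centered_gaussian_law.
Context d (O : measurableType d) (R : realType) (Pr : probability O R) (k : nat).
Variables (Y : {RV Pr >-> 'rV[R]_k}) (Sigma : 'M[R]_k).
Hypothesis cY : centered_gaussian Y Sigma.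
Let y i w := Y w 0 i.

Let measurable_y i : measurable_fun setT (y i).
Proof. exact: measurableT_comp (measurable_coord _ _) _. Qed.

(** A coordinate is the projection on a basis vector, hence has a one-dimensional Gaussian law and a
    finite second moment. All other integrability facts of the section follow from this one. *)
Let integrable_sqr_y i : Pr.-integrable setT (EFin \o (fun w => y i w ^+ 2)).
Proof.
have [gY _ _] := cY.
have [m [s [_ law]]] := gaussian_vector_dotv (delta_mx 0 i) gY.
apply/integrableP; split.
  by apply/measurable_EFinP; exact: measurable_funX.
have := gaussian_rv_sqr 0 law; rewrite addr0 => E.
rewrite (_ : integral _ _ _ = (s ^+ 2 + m ^+ 2)%:E) ?ltry// -E.
by apply: eq_integral => w _; rewrite /= ger0_norm ?sqr_ge0// addr0 dotv_delta.
Qed.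

Let integrable_cst (c : R) : Pr.-integrable setT (EFin \o (fun=> c)).
Proof. exact: finite_measure_integrable_cst. Qed.

Let integrable_yy i j : Pr.-integrable setT (EFin \o (fun w => y i w * y j w)).
Proof.
apply: (@dominated_integrable _ _ _ Pr setT _ (fun w => y i w ^+ 2 + y j w ^+ 2)) => //.
- exact: measurable_funM.
- by move=> w _; rewrite ler_norml; apply/andP; split; nra.
- by have := integrableD measurableT (integrable_sqr_y i) (integrable_sqr_y j); exact: eq_integrable.
Qed.

Let integrable_y i : Pr.-integrable setT (EFin \o y i).
Proof.
apply: (@dominated_integrable _ _ _ Pr setT _ (fun w => 1 + y i w ^+ 2)) => //.
- by move=> w _; rewrite ler_norml; apply/andP; split; nra.
- by have := integrableD measurableT (integrable_cst 1) (integrable_sqr_y i); exact: eq_integrable.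
Qed.

Let mean_y i : \int[Pr]_w y i w = 0.
Proof. by have [_ /(_ i) + _] := cY; rewrite unlock /Rintegral => ->. Qed.

Let cov_y i j : \int[Pr]_w (y i w * y j w) = Sigma i j.
Proof.
have [_ E0 /(_ i j)] := cY.
rewrite covariance.unlock !E0 /= unlock => E.
rewrite /Rintegral (_ : integral _ _ _ = (Sigma i j)%:E)// -E.
apply: eq_integral => w _; congr EFin; symmetry.
by transitivity ((Y w 0 i - 0) * (Y w 0 j - 0)) => //; rewrite !subr0.
Qed.

Let scale_int (c : R) (f : O -> R) : Pr.-integrable setT (EFin \o f) ->
  Pr.-integrable setT (EFin \o (fun w => c * f w)).
Proof. by move=> fi; have := integrableZl measurableT c fi; exact: eq_integrable. Qed.

(** Expanding the square of the projection by bilinearity gives the second moment [qform Sigma u].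
    Comparison with [gaussian_rv_sqr] for the shifts 0 and 1 forces m = 0 and s^2 = [qform Sigma u],
    which is therefore nonnegative. *)
Lemma centered_gaussian_rv (u : 'rV[R]_k) :
  0 <= qform Sigma u /\
  gaussian_rv Pr (fun w => dotv u (Y w)) 0 (Num.sqrt (qform Sigma u)).
Proof.
have [gY _ _] := cY.
have [m [s [s0 law]]] := gaussian_vector_dotv u gY.
pose Z w := dotv u (Y w).
have [iZ EZ] : Pr.-integrable setT (EFin \o Z) /\ \int[Pr]_w Z w = 0.
  have [iZ EZ] := @Rintegral_sum _ _ _ Pr _ (index_enum 'I_k) (fun i w => u 0 i * y i w)
    (fun i => scale_int _ (integrable_y i)).
  split => //; rewrite [LHS]EZ big1// => i _.
  by rewrite RintegralZl// mean_y mulr0.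
have ZZ w : Z w ^+ 2 = \sum_j \sum_i (u 0 i * u 0 j) * (y i w * y j w).
  rewrite /Z expr2 {2}/dotv mulr_sumr; apply: eq_bigr => j _.
  by rewrite /dotv mulr_suml; apply: eq_bigr => i _; rewrite /y; ring.
have i2 j := @Rintegral_sum _ _ _ Pr _ (index_enum 'I_k)
    (fun i w => (u 0 i * u 0 j) * (y i w * y j w))
    (fun i => scale_int _ (integrable_yy i j)).
have [i3 E3] := @Rintegral_sum _ _ _ Pr _ (index_enum 'I_k) _ (fun j => (i2 j).1).
have iZ2 : Pr.-integrable setT (EFin \o (fun w => Z w ^+ 2)).
  by apply: eq_integrable i3 => // w _ /=; rewrite ZZ.
have EZ2 : \int[Pr]_w (Z w ^+ 2) = qform Sigma u.
  under eq_Rintegral do rewrite ZZ.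
  rewrite E3 /qform /dotv; apply: eq_bigr => j _.
  rewrite (i2 j).2 mxE mulr_suml; apply: eq_bigr => i _.
  by rewrite RintegralZl// cov_y; ring.
have toR (f : O -> R) c : (\int[Pr]_w (f w)%:E = c%:E)%E -> \int[Pr]_w f w = c.
  by rewrite /Rintegral => ->.
have /toR := gaussian_rv_sqr 0 law.
under eq_Rintegral do rewrite addr0.
rewrite EZ2 addr0 => q0.
have /toR := gaussian_rv_sqr 1 law.
have -> : \int[Pr]_w ((dotv u (Y w) + 1) ^+ 2) =
    \int[Pr]_w (Z w ^+ 2 + (2 * Z w + 1)).
  by apply: eq_Rintegral => w _; rewrite /Z; ring.
have i21 : Pr.-integrable setT (EFin \o (fun w => 2 * Z w + 1)).
  by have := integrableD measurableT (scale_int 2 iZ) (integrable_cst 1); exact: eq_integrable.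
rewrite RintegralD// RintegralD//; last exact: scale_int.
rewrite RintegralZl// EZ EZ2 Rintegral_probability1 q0 => q1.
have m0 : m = 0 by move: q1; rewrite sqrrD; lra.
rewrite m0 in law; rewrite m0 expr0n/= addr0 sqr_ge0 sqrtr_sqr ger0_norm//.
Qed.

End centered_gaussian_law.

(** * The density of a centered Gaussian vector *)

Section gaussian_density.
Context d (O : measurableType d) (R : realType) (Pr : probability O R) (k : nat).
Variables (Y : {RV Pr >-> 'rV[R]_k}) (H : 'M[R]_k).
Hypotheses (Hs : H^T = H) (Hp : forall t, t != 0 -> 0 < qform H t).

Let Zc := Num.sqrt ((2 * pi) ^+ k / \det H).
Let w (x : 'rV[R]_k) := expR (- (qform H x / 2)).

Lemma gauss_norm_gt0 : 0 < Zc.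
Proof.
have [dH _] := gauss_cos_integral Hs Hp.
by rewrite sqrtr_gt0 divr_gt0// exprn_gt0// mulr_gt0// pi_gt0.
Qed.

Lemma integral_gauss : (\int[@lebesgue_rV R k]_x (w x)%:E = Zc%:E)%E.
Proof.
have [_ /(_ 0 0 0)] := gauss_cos_integral Hs Hp.
rewrite normr0 ler01 => /(_ isT); rewrite !mul0r addr0 mulr1 => <-.
by apply: eq_integral => x _; rewrite mul0r addr0 mul1r.
Qed.

Lemma integrable_gauss : (@lebesgue_rV R k).-integrable setT (EFin \o w).
Proof.
apply/integrableP; split; first by apply/measurable_EFinP; exact: measurable_gauss.
under eq_integral do rewrite /= ger0_norm ?expR_ge0//.
by rewrite integral_gauss ltry.
Qed.

Lemma posdef_unitmx : H \in unitmx.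
Proof.
have [dH _] := gauss_cos_integral Hs Hp.
by rewrite unitmxE unitfE gt_eqF.
Qed.

Lemma qform_invmx (u : 'rV[R]_k) : qform H (u *m invmx H) = qform (invmx H) u.
Proof. by rewrite /qform mulmxKV ?posdef_unitmx// dotvC. Qed.

(** This is [gauss_cos_integral] for v = u H^-1 and c = 1, with the total mass subtracted. *)
Lemma gauss_cos_invmx (u : 'rV[R]_k) (t : R) :
  \int[@lebesgue_rV R k]_x (cos (dotv u x + t) * w x) =
  Zc * (expR (- (qform (invmx H) u / 2)) * cos t).
Proof.
have [_ /(_ (u *m invmx H) 1 t)] := gauss_cos_integral Hs Hp.
rewrite normr1 lexx => /(_ isT); rewrite mulmxKV ?posdef_unitmx// qform_invmx => E.
have ic : (@lebesgue_rV R k).-integrable setT (EFin \o (fun x => cos (dotv u x + t) * w x)).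
  apply: (dominated_integrable _ _ _ integrable_gauss) => //.
    by apply: measurable_funM; [exact: measurable_cos_dotv|exact: measurable_gauss].
  by move=> x _; rewrite normrM (ger0_norm (expR_ge0 _)) ler_piMl ?expR_ge0 ?cos_max.
have : \int[@lebesgue_rV R k]_x (w x + cos (dotv u x + t) * w x) =
    Zc * (1 + expR (- (qform (invmx H) u / 2)) * cos t).
  rewrite /Rintegral [X in fine X](_ : _ = (Zc * (1 + expR (- (qform (invmx H) u / 2)) * cos t))%:E)//.
  move: E; rewrite mul1r => <-; apply: eq_integral => x _; congr EFin.
  by rewrite mul1r mulrDl mul1r.
rewrite RintegralD//; last exact: integrable_gauss.
by rewrite {1}/Rintegral integral_gauss /=; lra.
Qed.

Hypothesis cY : centered_gaussian Y (invmx H).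

Lemma centered_gaussian_density (A : set 'rV[R]_k) : measurable A ->
  Pr (Y @^-1` A) = (\int[@lebesgue_rV R k]_(x in A) (Zc^-1 * w x)%:E)%E.
Proof.
move=> mA.
have Z0 := gauss_norm_gt0.
pose g2 x := Zc^-1 * w x.
have mg2 : measurable_fun setT g2.
  by apply: measurable_funM => //; exact: measurable_gauss.
have g20 x : 0 <= g2 x by rewrite mulr_ge0 ?expR_ge0// invr_ge0 ltW.
have ig2 : (@lebesgue_rV R k).-integrable setT (EFin \o g2).
  by have := integrableZl measurableT Zc^-1 integrable_gauss; exact: eq_integrable.
have mY : measurable_fun setT Y by [].
have i1 : Pr.-integrable setT (EFin \o (fun=> 1)).
  exact: finite_measure_integrable_cst.
(* Both sides equal e^(-<H^-1 u, u>/2) cos t: the left one by the law of the projection on u, the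
   right one by [gauss_cos_invmx]. *)
have charE u t : wlaw Pr Y (fun=> 1) (fun x => cos (dotv u x + t)) =
    wlaw (@lebesgue_rV R k) id g2 (fun x => cos (dotv u x + t)).
  have [q0 law] := centered_gaussian_rv cY u.
  have E := gaussian_rv_cos t law.
  have ic : Pr.-integrable setT (EFin \o (fun x => cos (dotv u (Y x) + t) * 1)).
    apply: (dominated_integrable measurableT _ _ i1).
      apply: measurable_funM => //.
      exact: measurableT_comp (measurable_cos_dotv u t) mY.
    by move=> x _; rewrite mulr1 cos_max.
  transitivity (expR (- (qform (invmx H) u / 2)) * cos t).
    have : \int[Pr]_x (1 + cos (dotv u (Y x) + t) * 1) =
        1 + expR (- (qform (invmx H) u / 2)) * cos t.
      rewrite /Rintegral [X in fine X](_ : _ = (1 + expR (- (qform (invmx H) u / 2)) * cos t)%:E)//.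
      rewrite -[X in expR (- (X / 2))](sqr_sqrtr q0) -E.
      by apply: eq_integral => x _; rewrite mulr1.
    rewrite RintegralD// Rintegral_probability1.
    by rewrite /wlaw; lra.
  rewrite /wlaw -[LHS](mulKf (lt0r_neq0 Z0)) -gauss_cos_invmx.
  rewrite -RintegralZl//.
    by apply: eq_Rintegral => x _; rewrite /g2; ring.
  apply: (dominated_integrable _ _ _ integrable_gauss) => //.
    by apply: measurable_funM; [exact: measurable_cos_dotv|exact: measurable_gauss].
  by move=> x _; rewrite normrM (ger0_norm (expR_ge0 _)) ler_piMl ?expR_ge0 ?cos_max.
have m1 : measurable_fun setT (fun _ : O => 1 : R) by [].
have one0 (x : O) : 0 <= 1 :> R by [].
have mid : measurable_fun setT (@idfun 'rV[R]_k) by exact: measurable_id.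
have half := wlaw_half_spaces mY m1 one0 i1 mid mg2 g20 ig2 charE.
pose m2' : {measure set 'rV[R]_k -> \bar R} := density_measure (@lebesgue_rV R k) mg2 g20.
have : distribution Pr Y A = m2' A; last by [].
apply: (measure_unique (range (@half_spaces R k)) (fun=> setT)) => //.
- exact: measurable_rV_half_spaces.
- move=> _ _ [s1 _ <-] [s2 _ <-]; exists (s1 ++ s2) => //.
  exact: half_spaces_cat.
- by move=> _; exists [::] => //; apply/seteqP; split.
- by rewrite bigcup_const.
- move=> _ [s _ <-].
  have mh := measurable_half_spaces s.
  transitivity (\int[Pr]_(x in Y @^-1` (half_spaces s)) (1 : R)%:E)%E.
    rewrite integral_cst ?mul1e//.
    by rewrite -[X in measurable X]setTI; exact: measurable_funPT.
  rewrite (wlaw_indic mY m1 one0 i1)// half.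
  by rewrite -(wlaw_indic mid mg2 g20 ig2).
- by move=> _; rewrite -ge0_fin_numE// fin_num_measure.
Qed.

End gaussian_density.

(** * The Laplace method on a cone *)

Section laplace_cone.
Variables (R : realType) (d : nat).
Notation mu := (@lebesgue_rV R d).

Lemma qform_scalar (c : R) (t : 'rV[R]_d) : qform c%:M t = c * enorm t ^+ 2.
Proof. by rewrite /qform mul_mx_scalar dotvZl enorm2. Qed.

Lemma integrable_gauss_enorm (c : R) : 0 < c ->
  mu.-integrable setT (EFin \o (fun t => expR (- (c * enorm t ^+ 2)))).
Proof.
move=> c0.
have Hs : ((2 * c)%:M : 'M[R]_d)^T = (2 * c)%:M by rewrite tr_scalar_mx.
have Hp (t : 'rV[R]_d) : t != 0 -> 0 < qform (2 * c)%:M t.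
  by move=> t0; rewrite qform_scalar enorm2 !mulr_gt0// dotv_gt0.
apply: eq_integrable (integrable_gauss Hs Hp) => // t _ /=.
by rewrite qform_scalar; congr (expR (- _))%:E; field.
Qed.

(** The linear term bounds the amplitude error and the missing part outside the ball, the cubic term
    the error in the exponent; lam / 4 is the quadratic growth that phi retains near 0. *)
Definition laplace_majorant (lam A B : R) (t : 'rV[R]_d) : R :=
  (A * enorm t + B * enorm t ^+ 3) * expR (- (lam / 4 * enorm t ^+ 2)).

Lemma laplace_majorant_ge0 lam A B t : 0 <= A -> 0 <= B ->
  0 <= laplace_majorant lam A B t.
Proof.
move=> A0 B0; rewrite mulr_ge0 ?expR_ge0// addr_ge0// mulr_ge0 ?exprn_ge0//;
  exact: enorm_ge0.
Qed.

Lemma measurable_gauss_enorm (c : R) :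
  measurable_fun setT (fun t : 'rV[R]_d => expR (- (c * enorm t ^+ 2))).
Proof.
have m1 : measurable_fun setT (fun t : 'rV[R]_d => - (c * enorm t ^+ 2)).
  apply: measurable_funN; apply: measurable_funM => //; apply: measurable_funX.
  exact: measurable_enorm.
exact: measurableT_comp m1.
Qed.

Lemma measurable_laplace_majorant lam A B :
  measurable_fun setT (laplace_majorant lam A B).
Proof.
apply: measurable_funM; last exact: measurable_gauss_enorm.
apply: measurable_funD; apply: measurable_funM => //; first exact: measurable_enorm.
by apply: measurable_funX; exact: measurable_enorm.
Qed.

Lemma integrable_laplace_majorant (lam A B : R) : 0 < lam -> 0 <= A -> 0 <= B ->
  mu.-integrable setT (EFin \o laplace_majorant lam A B).
Proof.
move=> l0 A0 B0.
(* Put y = lam e^2 / 8. Then e <= 1 + e^2 and e^3 <= 1 + e^4, with e^2 = (8 / lam) y and e^4 = (256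
   / lam^2) (y^2 / 4), while y and y^2 / 4 are both below e^y. Half of the Gaussian weight pays for
   this. *)
pose C := A * (1 + 8 / lam) + B * (1 + 256 / lam ^+ 2).
have l8 : 0 < lam / 8 by rewrite divr_gt0.
apply: (@dominated_integrable _ _ _ mu setT _
  (fun t => C * expR (- (lam / 8 * enorm t ^+ 2)))) => //.
- exact: measurable_laplace_majorant.
- move=> t _; rewrite ger0_norm ?laplace_majorant_ge0// /laplace_majorant.
  set e := enorm t; have e0 : 0 <= e := enorm_ge0 t.
  have -> : expR (- (lam / 4 * e ^+ 2)) =
      expR (- (lam / 8 * e ^+ 2)) * expR (- (lam / 8 * e ^+ 2)).
    by rewrite -expRD; congr expR; field.
  rewrite mulrA ler_wpM2r ?expR_ge0// expRN ler_pdivrMr ?expR_gt0//.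
  set y := lam / 8 * e ^+ 2.
  have y0 : 0 <= y by rewrite mulr_ge0 ?sqr_ge0// ltW.
  have ey1 : 1 + y <= expR y := expR_ge1Dx y.
  have ey2 : 1 + y ^+ 2 / 4 <= expR y.
    rewrite (_ : y = y / 2 + y / 2); last by field.
    rewrite expRD; have := expR_ge1Dx (y / 2); set E := expR _ => hE.
    have : (1 + y / 2) * (1 + y / 2) <= E * E by rewrite ler_pM//; lra.
    by apply: le_trans; nra.
  have e2 : e ^+ 2 = 8 / lam * y by rewrite /y; field; rewrite gt_eqF.
  have h1 : e <= (1 + 8 / lam) * expR y.
    apply: (@le_trans _ _ (1 + e ^+ 2)); first by nra.
    have l1 : 0 <= 8 / lam by rewrite divr_ge0// ltW.
    by rewrite e2; nra.
  have h3 : e ^+ 3 <= (1 + 256 / lam ^+ 2) * expR y.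
    apply: (@le_trans _ _ (1 + (e ^+ 2) ^+ 2)).
      have [e1|e1] := leP e 1; first by have := exprn_ile1 3 e0 e1; have := sqr_ge0 (e ^+ 2); lra.
      have : e ^+ 3 <= e ^+ 4 by rewrite [leRHS]exprS ler_peMl ?exprn_ge0// ltW.
      by rewrite -exprM; lra.
    have -> : (e ^+ 2) ^+ 2 = 256 / lam ^+ 2 * (y ^+ 2 / 4).
      by rewrite e2; field; rewrite gt_eqF.
    have l1 : 0 <= 256 / lam ^+ 2 by rewrite divr_ge0// exprn_ge0// ltW.
    have := sqr_ge0 y; nra.
  rewrite /C mulrDl -!mulrA lerD// ler_wpM2l//.
- have := integrableZl measurableT C (integrable_gauss_enorm l8).
  exact: eq_integrable.
Qed.

(** For x <= y the difference is e^-x (1 - e^-(y - x)), and 1 - e^-h <= h. *)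
Lemma norm_sub_expR (w x y : R) : w <= x -> w <= y ->
  `|expR (- x) - expR (- y)| <= `|x - y| * expR (- w).
Proof.
wlog xy : x y / x <= y => [hw wx wy|wx wy].
  have [xy|/ltW yx] := leP x y; first exact: hw.
  by rewrite distrC (distrC x); exact: hw.
rewrite ger0_norm ?subr_ge0 ?ler_expR ?lerN2// ler0_norm ?subr_le0// opprB.
have -> : expR (- y) = expR (- x) * expR (- (y - x)).
  by rewrite -expRD; congr expR; ring.
have h : 1 - expR (- (y - x)) <= y - x by have := expR_ge1Dx (- (y - x)); lra.
have hw : expR (- x) <= expR (- w) by rewrite ler_expR lerN2.
rewrite -[X in X - _]mulr1 -mulrBr mulrC ler_pM ?expR_ge0// subr_ge0.
by rewrite -[leRHS]expR0 ler_expR oppr_le0 subr_ge0.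
Qed.

Lemma coneP (C : set 'rV[R]_d) (c : R) v : is_cone C -> 0 < c ->
  (c *: v \in C) = (v \in C).
Proof.
move=> [_ cC] c0; apply/idP/idP; rewrite !inE => h; last exact: cC.
rewrite -[v]scale1r -(mulVf (lt0r_neq0 c0)) -scalerA.
by apply: cC h; rewrite invr_gt0.
Qed.

Lemma Rintegral_scale (c : R) (f : 'rV[R]_d -> R) : 0 < c ->
  mu.-integrable setT (EFin \o f) -> (forall x, 0 <= f x) ->
  \int[mu]_t f (c *: t) = c ^- d * \int[mu]_t f t.
Proof.
move=> c0 fi f0; have mf : measurable_fun setT f.
  by have /integrableP[/measurable_EFinP] := fi.
have := @ge0_integral_scale R d c (EFin \o f) c0.
move=> /(_ _ _)/= E; rewrite /Rintegral E//; last exact/measurable_EFinP.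
by rewrite fineM//; exact: integrable_fin_num.
Qed.

Lemma Rintegral_cone_gauss (C : set 'rV[R]_d) (q : 'rV[R]_d -> R) (c : R) :
  is_cone C -> measurable C -> 0 < c -> measurable_fun setT q ->
  (forall a v, q (a *: v) = a ^+ 2 * q v) ->
  mu.-integrable C (EFin \o (fun t => expR (- (q t / 2)))) ->
  \int[mu]_(t in C) expR (- (c ^+ 2 * q t / 2)) =
  c ^- d * \int[mu]_(t in C) expR (- (q t / 2)).
Proof.
move=> coC mC c0 mq qZ iC.
rewrite Rintegral_mkcond [in RHS]Rintegral_mkcond -Rintegral_scale//; last 2 first.
- by rewrite -restrict_EFin; apply/(integrable_mkcond _ mC).
- by move=> x; rewrite patchE; case: ifPn => // _; exact: expR_ge0.
by apply: eq_Rintegral => t _; rewrite !patchE coneP// qZ.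
Qed.

(** It depends on uniform bounds only, neither on the base point nor on z. [M / r] comes from the
    region |s| >= r, and [M * B] is the exponent error multiplied by the bound on |a(p)|. *)
Definition cone_laplace_const (lam A B M r : R) : R :=
  \int[mu]_t laplace_majorant lam (A + M / r) (M * B) t.

Lemma integrable_laplace (C : set 'rV[R]_d) (b phi : 'rV[R]_d -> R)
    (lam A M r z b0 : R) :
  0 < lam -> 0 < z -> 0 < r -> 0 <= A -> measurable (C `&` eball r) ->
  measurable_fun (C `&` eball r) b -> measurable_fun (C `&` eball r) phi ->
  `|b0| <= M ->
  (forall s, (C `&` eball r) s -> `|b s - b0| <= A * enorm s) ->
  (forall s, (C `&` eball r) s -> lam / 4 * enorm s ^+ 2 <= phi s) ->
  mu.-integrable (C `&` eball r) (EFin \o (fun s => b s * expR (- (z * phi s)))).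
Proof.
move=> l0 z0 r0 A0 mD mb mphi b0M bA phil.
have c0 : 0 < z * (lam / 4) by rewrite mulr_gt0// divr_gt0.
apply: (@dominated_integrable _ _ _ mu _ _
  (fun s => (M + A * r) * expR (- (z * (lam / 4) * enorm s ^+ 2)))) => //.
- apply: measurable_funM => //.
  apply: (measurableT_comp (f := @expR R)) => //.
  by apply: measurable_funN; apply: measurable_funM.
- move=> s Ds; rewrite normrM (ger0_norm (expR_ge0 _)) ler_pM ?expR_ge0//.
    rewrite -[b s](subrK b0) (le_trans (ler_normD _ _))// addrC lerD//.
    rewrite (le_trans (bA _ Ds))// ler_wpM2l//; case: Ds => _.
    by rewrite /eball/= => /ltW.
  rewrite ler_expR lerN2 -mulrA ler_pM2l//; exact: phil.
- apply: (integrableS measurableT) => //.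
  have := integrableZl measurableT (M + A * r) (integrable_gauss_enorm c0).
  exact: eq_integrable.
Qed.

Lemma laplace_cone_bound (C : set 'rV[R]_d) (b phi q : 'rV[R]_d -> R)
    (lam A B M r rho b0 : R) :
  is_cone C -> measurable C ->
  0 < lam -> 0 < rho -> 0 < r -> 0 <= A -> 0 <= B ->
  measurable_fun (C `&` eball r) b -> measurable_fun (C `&` eball r) phi ->
  measurable_fun setT q -> (forall a v, q (a *: v) = a ^+ 2 * q v) ->
  (forall v, lam * enorm v ^+ 2 <= q v) -> `|b0| <= M ->
  (forall s, (C `&` eball r) s -> `|b s - b0| <= A * enorm s) ->
  (forall s, (C `&` eball r) s -> `|phi s - q s / 2| <= B * enorm s ^+ 3) ->
  (forall s, (C `&` eball r) s -> lam / 4 * enorm s ^+ 2 <= phi s) ->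
  `|\int[mu]_(s in C `&` eball r) (b s * expR (- (rho ^+ 2 * phi s))) -
    rho ^- d * (b0 * \int[mu]_(t in C) expR (- (q t / 2)))| <=
  cone_laplace_const lam A B M r * rho ^-1 * rho ^- d.
Proof.
move=> coC mC l0 rho0 r0 A0 B0 mb mphi mq qZ ql b0M bA phiq phil.
have half_le (x y : R) : 0 <= x -> x <= y -> x / 4 <= y / 2 by lra.
have M0 : 0 <= M by rewrite (le_trans _ b0M).
have AM0 : 0 <= A + M / r by rewrite addr_ge0// divr_ge0// ltW.
have MB0 : 0 <= M * B by rewrite mulr_ge0.
have z0 : 0 < rho ^+ 2 by rewrite exprn_gt0.
have mD : measurable (C `&` eball r) by apply: measurableI => //; exact: measurable_eball.
have iq c : 0 < c -> mu.-integrable C (EFin \o (fun t => expR (- (c * q t / 2)))).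
  move=> c0; have cl0 : 0 < c * lam / 2 by rewrite divr_gt0// mulr_gt0.
  apply: (@dominated_integrable _ _ _ mu _ _
    (fun s => expR (- (c * lam / 2 * enorm s ^+ 2)))) => //.
  - apply: (measurableT_comp (f := @expR R)) => //.
    apply: measurable_funN; apply: measurable_funM => //; apply: measurable_funM => //.
    exact: measurable_funTS.
  - move=> s _; rewrite ger0_norm ?expR_ge0// ler_expR lerN2.
    rewrite -!mulrA ler_pM2l// mulrCA [X in _ <= X]mulrC ler_pM2l ?invr_gt0//.
  - by apply: (integrableS measurableT) => //; exact: integrable_gauss_enorm.
rewrite mulrCA -(Rintegral_cone_gauss coC)//; last first.
  by have := iq 1 ltr01; apply: eq_integrable => // t _; rewrite /= mul1r.
have iE := iq _ z0.
rewrite -RintegralZl//.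
set f1 := fun s => b s * _; set f2 := fun s => b0 * _.
have if1 : mu.-integrable (C `&` eball r) (EFin \o f1).
  exact: (integrable_laplace l0 z0 r0 A0 mD mb mphi b0M bA phil).
have if2 : mu.-integrable C (EFin \o f2).
  by have := integrableZl mC b0 iE; exact: eq_integrable.
have jf1 : mu.-integrable setT (EFin \o (f1 \_ (C `&` eball r))).
  by rewrite -restrict_EFin; apply/(integrable_mkcond _ mD).
have jf2 : mu.-integrable setT (EFin \o (f2 \_ C)).
  by rewrite -restrict_EFin; apply/(integrable_mkcond _ mC).
rewrite Rintegral_mkcond [X in _ - X]Rintegral_mkcond -RintegralB//.
have j12 : mu.-integrable setT
    (EFin \o (fun s => (f1 \_ (C `&` eball r)) s - (f2 \_ C) s)).
  by have := integrableB measurableT jf1 jf2; exact: eq_integrable.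
rewrite (le_trans (le_normr_Rintegral _ _))//.
pose D := laplace_majorant lam (A + M / r) (M * B).
have iD : mu.-integrable setT (EFin \o D) by exact: integrable_laplace_majorant.
have D0 t : 0 <= D t by exact: laplace_majorant_ge0.
have mDr : measurable_fun setT (fun t : 'rV[R]_d => D (rho *: t)).
  apply: (measurableT_comp (f := D)); first exact: measurable_laplace_majorant.
  exact: measurable_scale.
have E := Rintegral_scale rho0 iD D0.
have iDr : mu.-integrable setT (EFin \o (fun t : 'rV[R]_d => D (rho *: t))).
  apply/integrableP; split; first exact/measurable_EFinP.
  under eq_integral do rewrite /= ger0_norm//.
  have mED : measurable_fun setT (EFin \o D).
    by apply/measurable_EFinP; exact: measurable_laplace_majorant.
  rewrite (@ge0_integral_scale R d rho (EFin \o D) rho0 mED)//.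
  apply: lte_mul_pinfty => //; first by rewrite lee_fin invr_ge0 exprn_ge0// ltW.
  have /integrableP[_] := iD; apply: le_lt_trans.
  by rewrite le_eqVlt; apply/orP; left; apply/eqP; apply: eq_integral => t _ /=;
    rewrite ger0_norm.
have -> : cone_laplace_const lam A B M r / rho / rho ^+ d =
    rho^-1 * \int[mu]_t D (rho *: t).
  by rewrite E /cone_laplace_const -/D mulrAC mulrC; congr (_ * _); exact: mulrC.
have iDr1 : mu.-integrable setT (EFin \o (fun t => rho^-1 * D (rho *: t))).
  by have := integrableZl measurableT rho^-1 iDr; exact: eq_integrable.
rewrite -RintegralZl//.
apply: le_Rintegral => //.
  have := integrable_abse j12; exact: eq_integrable.
move=> s _ /=.
have en0 := enorm_ge0 s; set e := enorm s in en0.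
(* This is the pointwise majorant of the remainder. The factor rho^-1 is the gain z^(-1/2): it
   leaves e in the linear term and rho^2 e^3 in the cubic one, which is the size of rho^2 times the
   error of phi. *)
have DE : rho^-1 * D (rho *: s) = ((A + M / r) * e + M * (rho ^+ 2 * (B * e ^+ 3))) *
    expR (- (rho ^+ 2 * (lam / 4 * e ^+ 2))).
  rewrite /D /laplace_majorant enormZ ?ltW// -/e.
  have -> : lam / 4 * (rho * e) ^+ 2 = rho ^+ 2 * (lam / 4 * e ^+ 2) by ring.
  by field; rewrite !gt_eqF.
have T0 : 0 <= M * (rho ^+ 2 * (B * e ^+ 3)).
  by rewrite !mulr_ge0 ?exprn_ge0// ltW.
rewrite DE !patchE.
case: (boolP (s \in C)) => sC; last first.
  rewrite memNset => [|[Cs _]]; last by move: sC; rewrite notin_setE.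
  by rewrite subrr normr0 mulr_ge0 ?expR_ge0// addr_ge0// mulr_ge0.
have wq : rho ^+ 2 * (lam / 4 * e ^+ 2) <= rho ^+ 2 * q s / 2.
  rewrite -[leRHS]mulrA ler_pM2l//; have := ql s; rewrite -/e => h.
  by rewrite mulrAC half_le// mulr_ge0 ?sqr_ge0// ltW.
case: (boolP (s \in C `&` eball r)) => sD; last first.
  (* Outside the ball only the model Gaussian remains, and M <= (M / r) e there. *)
  have er : r <= e.
    rewrite leNgt; apply/negP => er; move: sD; rewrite notin_setE; apply.
    by split => //; move: sC; rewrite inE.
  rewrite sub0r normrN /f2 normrM (ger0_norm (expR_ge0 _)).
  rewrite ler_pM ?expR_ge0//; last by rewrite ler_expR lerN2.
  rewrite (le_trans b0M)//; apply: (@le_trans _ _ (M / r * e)).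
    by rewrite -mulrA ler_peMr// mulrC ler_pdivlMr// mul1r.
  by rewrite mulrDl addrAC lerDr addr_ge0// mulr_ge0.
have Ds : (C `&` eball r) s by move: sD; rewrite inE.
rewrite /f1 /f2.
(* Amplitude error plus exponent error; the second is estimated by [norm_sub_expR]. *)
have -> : b s * expR (- (rho ^+ 2 * phi s)) - b0 * expR (- (rho ^+ 2 * q s / 2)) =
    (b s - b0) * expR (- (rho ^+ 2 * phi s)) +
    b0 * (expR (- (rho ^+ 2 * phi s)) - expR (- (rho ^+ 2 * q s / 2))) by ring.
rewrite (le_trans (ler_normD _ _))// !normrM (ger0_norm (expR_ge0 _)).
have wp : rho ^+ 2 * (lam / 4 * e ^+ 2) <= rho ^+ 2 * phi s.
  by rewrite ler_pM2l//; exact: phil.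
set W := expR (- (rho ^+ 2 * (lam / 4 * e ^+ 2))).
have W0 : 0 <= W := expR_ge0 _.
rewrite mulrDl lerD//.
  rewrite ler_pM ?expR_ge0// ?ler_expR ?lerN2// (le_trans (bA _ Ds))//.
  by rewrite mulrDl lerDl mulr_ge0// divr_ge0// ltW.
rewrite -[leRHS]mulrA ler_pM// (le_trans (norm_sub_expR wp wq))// ler_wpM2r//.
rewrite -mulrA -mulrBr normrM gtr0_norm// ler_pM2l//; exact: phiq.
Qed.

End laplace_cone.

(** * Normal cells *)

(** Continuity is known only at the points of D, so the preimage of an open set need not be open;
    within D it coincides with its interior. *)
Lemma measurable_fun_borel_continuous (R : realType) (d : nat) (N : ptopologicalType)
    (D : set 'rV[R]_d) (F : 'rV[R]_d -> N) : measurable D ->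
  (forall s, D s -> {for s, continuous F}) ->
  measurable_fun D (F : 'rV[R]_d -> borel N).
Proof.
move=> mD cF.
apply: (@measurability _ _ _ _ D (F : 'rV[R]_d -> borel N) (@open N)) => //.
move=> _ [U oU <-].
rewrite (_ : D `&` _ = D `&` (F @^-1` U)^°).
  by apply: measurableI => //; apply: open_measurable_mx; exact: open_interior.
apply/seteqP; split => s [Ds Us]; split => //.
  by apply: cF => //; exact: open_nbhs_nbhs.
exact: interior_subset.
Qed.

Section complex_parts.
Variable R : realType.
Implicit Types x y : R[i].

Lemma normRe_le_cabs x : `|complex.Re x| <= cabs x.
Proof.
by case: x => u v; rewrite /cabs/= -(sqrtr_sqr u) ler_wsqrtr// lerDl sqr_ge0.
Qed.

Lemma normIm_le_cabs x : `|complex.Im x| <= cabs x.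
Proof.
by case: x => u v; rewrite /cabs/= -(sqrtr_sqr v) ler_wsqrtr// lerDr sqr_ge0.
Qed.

Lemma cabs_le x : cabs x <= `|complex.Re x| + `|complex.Im x|.
Proof.
case: x => u v; rewrite /cabs/= -[leRHS]ger0_norm ?addr_ge0// -sqrtr_sqr.
rewrite ler_wsqrtr// sqrrD -(real_normK (num_real u)) -(real_normK (num_real v)).
by rewrite lerD2r lerDl mulrn_wge0// mulr_ge0.
Qed.

End complex_parts.

Lemma powRN_half (R : realType) (z : R) (d : nat) : 0 <= z ->
  z `^ (- (d%:R / 2)) = Num.sqrt z ^- d.
Proof.
by move=> z0; rewrite powRN mulrC powRrM powR12_sqrt// powR_mulrn// sqrtr_ge0.
Qed.

Section normal_cell.
Variables (R : realType) (n : nat) (N : ptopologicalType).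
Variables (g : riemannian R n N) (vol : {measure set (borel N) -> \bar R}).
Variables (M : set N) (eps : R) (S : normal_cells g vol M eps) (k : piece_ix S).

(** The regularity of [F] is expressed in local parametrizations of the stratum, so p is first
    written as psi u, and joint continuity at (u, s) is restricted to the slice of u. *)
Lemma F_continuous p s : piece S k p -> enorm s < eps ->
  {for s, continuous (F S k p)}.
Proof.
move=> Pp se.
have := @stratum_submanifold _ _ _ _ _ _ _ S _ _ (@piece_stratum _ _ _ _ _ _ _ S k _ Pp).
move=> [V [psi [lp [u Vu up]]]].
have [c _] := @F_C1 _ _ _ _ _ _ _ S k V psi lp.
have cus : {for (u, s), continuous (fun w : 'rV[R]_(piece_dim _ _ _ _ _ _ _ S k) * 'rV[R]_(codim S k) =>
    F S k (psi w.1) w.2)}.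
  by apply: c; split => //=; rewrite up; exact: (@piece_sub_nbhs _ _ _ _ _ _ _ S k).
have cp : {for s, continuous (fun s : 'rV[R]_(codim S k) => (u, s))}.
  by move=> W; apply: (@cvg_pair _ _ _ (nbhs s) (nbhs u) (nbhs s));
    [exact: cvg_cst|exact: cvg_id].
by have := continuous_comp cp cus; rewrite /comp/= up.
Qed.

Lemma measurable_cell p : piece S k p -> measurable (cell S k p).
Proof.
move=> Pp.
have := measurable_xsection (p : borel N) (@cell_graph _ _ _ _ _ _ _ S k).
congr measurable; apply/seteqP; split => v; rewrite /xsection/= inE/=.
  by case.
by split.
Qed.

Lemma measurable_cell_domain r : measurable (cell_domain (piece S k) (cell S k) r).
Proof.
rewrite (_ : cell_domain _ _ _ = [set x : borel N * 'rV[R]_(codim S k) |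
    piece S k x.1 /\ cell S k x.1 x.2] `&` (setT `*` eball r)).
  apply: measurableI; first exact: (@cell_graph _ _ _ _ _ _ _ S k).
  by apply: measurableX => //; exact: measurable_eball.
by apply/seteqP; split => -[x v] /=; rewrite /cell_domain /=; tauto.
Qed.

Lemma measurable_jac p : piece S k p ->
  measurable_fun (cell S k p `&` eball eps) (jac S k p).
Proof.
move=> Pp.
apply: (measurable_comp (measurable_cell_domain eps) _ (@jac_measurable _ _ _ _ _ _ _ S k)
  (g := fun s => (p : borel N, s))).
- by move=> _ [s Ds <-].
- exact: measurable_funTS (pair1_measurable _).
Qed.

Lemma measurable_fun_F r p (h : borel N -> R) : r <= eps -> piece S k p ->
  measurable_fun setT h ->
  measurable_fun (cell S k p `&` eball r) (fun s => h (F S k p s)).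
Proof.
move=> re Pp mh.
have mD : measurable (cell S k p `&` eball r).
  by apply: measurableI; [exact: measurable_cell|exact: measurable_eball].
apply: (measurableT_comp mh); apply: measurable_fun_borel_continuous => //.
move=> s [_ sr]; apply: F_continuous => //.
exact: lt_le_trans re.
Qed.

End normal_cell.

(** [pr] stands for the real or the imaginary part; the three conditions on it are all that the
    passage from complex to real amplitudes uses. *)
Lemma laplace_component (R : realType) (n : nat) (N : ptopologicalType)
    (g : riemannian R n N) (vol : {measure set (borel N) -> \bar R})
    (f : N -> R) (a : N -> R[i]) (eps : R)
    (S : normal_cells g vol (argmin f) eps) (k : piece_ix S)
    (Hp : 'M[R]_(codim S k)) (lam A B M r z : R) (p : N) (pr : R[i] -> R) :
  (forall x c, pr (x * c%:C%C) = pr x * c) ->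
  (forall x y, pr (x - y) = pr x - pr y) -> (forall x, `|pr x| <= cabs x) ->
  measurable_fun setT ((fun x => pr (a x)) : borel N -> R) ->
  continuous f -> piece S k p -> is_cone (cell S k p) ->
  0 < lam -> 0 < z -> 0 < r -> r <= eps -> 0 <= A -> 0 <= B ->
  B * r <= lam / 4 -> cabs (a p) <= M ->
  (forall t, lam * enorm t ^+ 2 <= qform Hp t) ->
  (forall s, (cell S k p `&` eball r) s ->
    `|f (F S k p s) - inf_value f - qform Hp s / 2| <= B * enorm s ^+ 3) ->
  (forall s, (cell S k p `&` eball r) s ->
    cabs (a (F S k p s) * (jac S k p s)%:C%C - a p) <= A * enorm s) ->
  let I := laplace_integrand f a (F S k) (jac S k) z p in
  let dom := cell S k p `&` eball r in
  let mu := @lebesgue_rV R (codim S k) in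
  mu.-integrable dom (EFin \o (fun s => pr (I s))) /\
  exists2 e : R,
    `|e| <= cone_laplace_const (codim S k) lam A B M r * z `^ (- (1 / 2)) &
    \int[mu]_(s in dom) pr (I s) =
      expR (- (z * inf_value f)) * z `^ (- ((codim S k)%:R / 2)) *
      (pr (a p) * gauss_integral_on Hp (cell S k p) + e).
Proof.
move=> prZ prB prle mpr cf Pp coC l0 z0 r0 re A0 B0 Br aM ql fE aE I dom mu.
have mC := measurable_cell Pp.
have mD : measurable dom by apply: measurableI => //; exact: measurable_eball.
pose b s := pr (a (F S k p s)) * jac S k p s.
pose phi s := f (F S k p s) - inf_value f.
have mb : measurable_fun dom b.
  apply: measurable_funM; first exact: (measurable_fun_F re Pp mpr).
  apply: measurable_funS (measurable_jac Pp).
    by apply: measurableI => //; exact: measurable_eball.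
  by move=> s [Cs sr]; split => //; exact: lt_le_trans re.
have mf : measurable_fun setT (f : borel N -> R).
  apply: (measurability _ (RGenOpens.measurableE R)) => _ [_ [x [y ->]] <-].
  rewrite setTI; apply: sub_sigma_algebra.
  by apply: open_comp => // t _; exact: cf.
have mphi : measurable_fun dom phi.
  by apply: measurable_funB => //; exact: (measurable_fun_F re Pp mf).
have bA s : dom s -> `|b s - pr (a p)| <= A * enorm s.
  by move=> Ds; rewrite /b -prZ -prB (le_trans (prle _))//; exact: aE.
have phiB s : dom s -> `|phi s - qform Hp s / 2| <= B * enorm s ^+ 3.
  exact: fE.
(* On the ball B |s|^3 <= B r |s|^2 <= lam |s|^2 / 4, and the quadratic part is at least lam |s|^2 /
   2. *)
have phil s : dom s -> lam / 4 * enorm s ^+ 2 <= phi s.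
  move=> Ds; have := phiB s Ds; rewrite ler_norml => /andP[+ _].
  have e0 := enorm_ge0 s; have := ql s.
  have : B * enorm s ^+ 3 <= lam / 4 * enorm s ^+ 2.
    rewrite exprS mulrA ler_wpM2r ?sqr_ge0// (le_trans _ Br)// ler_wpM2l//.
    by case: Ds => _ /ltW.
  lra.
have M0 : `|pr (a p)| <= M by rewrite (le_trans (prle _)).
have IE s : pr (I s) = expR (- (z * inf_value f)) * (b s * expR (- (z * phi s))).
  rewrite /I /laplace_integrand prZ /b /phi.
  have -> : expR (- (z * f (F S k p s))) =
      expR (- (z * inf_value f)) * expR (- (z * (f (F S k p s) - inf_value f))).
    by rewrite -expRD; congr expR; ring.
  ring.
have iI := integrable_laplace l0 z0 r0 A0 mD mb mphi M0 bA phil.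
split.
  have := integrableZl mD (expR (- (z * inf_value f))) iI.
  by apply: eq_integrable => // s _ /=; rewrite IE.
have rho0 : 0 < Num.sqrt z by rewrite sqrtr_gt0.
have := laplace_cone_bound coC mC l0 rho0 r0 A0 B0 mb mphi
  (measurable_qform Hp) (qformZ Hp) ql M0 bA phiB phil.
rewrite sqr_sqrtr; last exact: ltW.
set X := \int[_]_(s in _) _; set G := \int[_]_(t in _) _ => XG.
have -> : z `^ (- (1 / 2)) = (Num.sqrt z)^-1.
  by rewrite mul1r powRN powR12_sqrt// ltW.
rewrite powRN_half; last exact: ltW.
set P := Num.sqrt z ^- codim S k.
have P0 : 0 < P by rewrite invr_gt0 exprn_gt0.
exists (P^-1 * X - pr (a p) * G).
  rewrite -(ler_pM2r P0) -[X in _ * X](gtr0_norm P0) -normrM.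
  rewrite (le_trans _ XG)// le_eqVlt; apply/orP; left; apply/eqP; congr `|_|.
  by rewrite mulrBl mulrAC mulVf ?gt_eqF// mul1r (mulrC P).
have -> : \int[mu]_(s in dom) pr (I s) = expR (- (z * inf_value f)) * X.
  by rewrite /X -RintegralZl//; apply: eq_Rintegral => s _; rewrite IE.
rewrite /gauss_integral_on -/G addrC subrK.
by rewrite -mulrA; congr (_ * _); rewrite mulrA mulfV ?gt_eqF// mul1r.
Qed.

Theorem corollary5p1 (R : realType) (n : nat) (N : ptopologicalType)
    (g : riemannian R n N) (vol : {measure set (borel N) -> \bar R})
    (f : N -> R) (a : N -> R[i]) (eps : R)
    (S : normal_cells g vol (argmin f) eps) (k : piece_ix S)
    (H : N -> 'M[R]_(codim S k)) (lam_minus lam_plus : R)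
    (vol_riem : riem_volume g n setT vol)
    (f_cont : continuous f)
    (f_bounded_below : has_lbound (range f))
    (a_meas : cmeasurable_fun setT (a : borel N -> R[i]))
    (M_nonempty : argmin f !=set0)
    (M_compact : compact (argmin f))
    (codim_ge1 : (1 <= codim S k)%N)
    (cell_cone : forall p, piece S k p -> is_cone (cell S k p))
    (a_bounded : exists K : R, forall x,
      cell_tube (piece S k) (cell S k) (F S k) eps x -> cabs (a x) <= K)
    (f_expansion : unif_bigO (piece S k) (cell S k) eps
      (fun p s => f (F S k p s) - inf_value f - qform (H p) s / 2) 3)
    (aJ_expansion : unif_bigO (piece S k) (cell S k) eps
      (fun p s => cabs (a (F S k p s) * (jac S k p s)%:C%C - a p)) 1)
    (H_sym : forall p, piece S k p -> (H p)^T = H p)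
    (H_meas : measurable_fun (piece S k : set (borel N))
      (H : borel N -> 'M[R]_(codim S k)))
    (lam_minus_gt0 : 0 < lam_minus)
    (lam_le : lam_minus <= lam_plus)
    (H_bounds : forall p t, piece S k p ->
      lam_minus * enorm t ^+ 2 <= qform (H p) t <= lam_plus * enorm t ^+ 2) :
  (exists2 eps0 : R, 0 < eps0 &
    forall r : R, 0 < r -> r <= eps -> r < eps0 ->
    exists Z K : R, 0 < Z /\ forall z p, Z <= z -> piece S k p ->
      let I := laplace_integrand f a (F S k) (jac S k) z p in
      let dom := cell S k p `&` eball r in
      cintegrable (@lebesgue_rV R (codim S k)) dom I /\
      exists2 rem : R[i], cabs rem <= K * z `^ (- (1 / 2)) &
        cintegral (@lebesgue_rV R (codim S k)) dom I =
        (expR (- (z * inf_value f)) * z `^ (- ((codim S k)%:R / 2)))%:C%C *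
        (a p * (gauss_integral_on (H p) (cell S k p))%:C%C + rem)) /\
  (forall p, piece S k p ->
    forall dO (O : measurableType dO) (Pr : probability O R)
      (Y : {RV Pr >-> 'rV[R]_(codim S k)}),
    centered_gaussian Y (invmx (H p)) ->
    [/\ gauss_integral_on (H p) (cell S k p) =
          (2 * pi) `^ ((codim S k)%:R / 2) / Num.sqrt (\det (H p)) *
          fine (Pr (Y @^-1` cell S k p)),
        cell S k p = setT -> Pr (Y @^-1` cell S k p) = 1%E &
        forall u, u != 0 -> cell S k p = [set t | 0 <= dotv u t] ->
          Pr (Y @^-1` cell S k p) = (1 / 2)%:E]).
Proof.
split.
  have [K3 [d3 [d30 hf]]] := f_expansion.
  have [K1 [d1 [d10 ha]]] := aJ_expansion.
  have [Ka hKa] := a_bounded.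
  (* The constants of the hypotheses carry no sign; absolute values make them nonnegative without
     weakening the bounds. *)
  pose A := `|K1|; pose B := `|K3|; pose M := `|Ka|.
  have A0 : 0 <= A := normr_ge0 _.
  have B0 : 0 <= B := normr_ge0 _.
  (* Both expansions hold below d1 and d3; the last term yields B r <= lam_minus / 4, with B + 1 to
     avoid dividing by 0. *)
  exists (Num.min d1 (Num.min d3 (lam_minus / (4 * (B + 1))))).
    by rewrite !lt_min d10 d30 divr_gt0// mulr_gt0// ltr_wpDl.
  move=> r r0 re; rewrite !lt_min => /and3P[r1 r3].
  rewrite ltr_pdivlMr ?mulr_gt0 ?ltr_wpDl// => rB.
  have Br : B * r <= lam_minus / 4 by lra.
  pose c := cone_laplace_const (codim S k) lam_minus A B M r.
  (* The bound holds for every z > 0, so the threshold 1 is only a choice; the factor 2 adds the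
     remainders of the two parts. *)
  exists 1, (2 * c); split => // z p z1 Pp I dom.
  have z0 : 0 < z := lt_le_trans ltr01 z1.
  (* The point p lies in the tube, being the image of (p, 0), and a cone contains 0. *)
  have aM : cabs (a p) <= M.
    rewrite (le_trans (hKa p _)) ?ler_norm//; exists (p, 0).
      split => //=; split; first by have [] := cell_cone _ Pp.
      by rewrite /eball/= /enorm dotv0l sqrtr0; exact: radius_gt0 S.
    by rewrite /= (@F0 _ _ _ _ _ _ _ S)//; exact: (@piece_sub_nbhs _ _ _ _ _ _ _ S).
  have ql t : lam_minus * enorm t ^+ 2 <= qform (H p) t.
    by have /andP[] := H_bounds p t Pp.
  have fE s : dom s ->
      `|f (F S k p s) - inf_value f - qform (H p) s / 2| <= B * enorm s ^+ 3.
    move=> [Cs sr]; have s3 : enorm s < d3 := lt_trans sr r3.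
    rewrite (le_trans (hf p s Pp Cs (lt_le_trans sr re) s3))//.
    by rewrite ler_wpM2r ?ler_norm// exprn_ge0// enorm_ge0.
  have aE s : dom s ->
      cabs (a (F S k p s) * (jac S k p s)%:C%C - a p) <= A * enorm s.
    move=> [Cs sr]; have s1 : enorm s < d1 := lt_trans sr r1.
    rewrite (le_trans (ler_norm _))//.
    rewrite (le_trans (ha p s Pp Cs (lt_le_trans sr re) s1))//.
    by rewrite expr1 ler_wpM2r ?ler_norm// enorm_ge0.
  have [mRe mIm] := a_meas.
  have ReZ (x : R[i]) (t : R) : complex.Re (x * t%:C%C) = complex.Re x * t.
    by case: x => u v /=; rewrite mulr0 subr0.
  have ImZ (x : R[i]) (t : R) : complex.Im (x * t%:C%C) = complex.Im x * t.
    by case: x => u v /=; rewrite mulr0 add0r.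
  have ReB (x y : R[i]) : complex.Re (x - y) = complex.Re x - complex.Re y.
    by case: x y => u v [u' v'].
  have ImB (x y : R[i]) : complex.Im (x - y) = complex.Im x - complex.Im y.
    by case: x y => u v [u' v'].
  have [iRe [eR eRc ER]] := laplace_component ReZ ReB (@normRe_le_cabs R) mRe
    f_cont Pp (cell_cone _ Pp) lam_minus_gt0 z0 r0 re A0 B0 Br aM ql fE aE.
  have [iIm [eI eIc EI]] := laplace_component ImZ ImB (@normIm_le_cabs R) mIm
    f_cont Pp (cell_cone _ Pp) lam_minus_gt0 z0 r0 re A0 B0 Br aM ql fE aE.
  split; first by split.
  exists (eR +i* eI)%C.
    rewrite (le_trans (cabs_le _))//= /c -mulrA mulr2n mulrDl mul1r.
    exact: lerD.
  rewrite /cintegral /I /dom ER EI; case: (a p) => u v.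
  by apply/eqP; rewrite eq_complex /=; apply/andP; split; apply/eqP; ring.
move=> p Pp dO O Pr Y cY.
have Hs := H_sym _ Pp.
have Hp t : t != 0 -> 0 < qform (H p) t.
  move=> t0; have /andP[+ _] := H_bounds p t Pp; apply: lt_le_trans.
  by rewrite mulr_gt0// enorm2 dotv_gt0.
have mC := measurable_cell Pp.
have Z0 := gauss_norm_gt0 Hs Hp.
split.
- have -> := centered_gaussian_density Hs Hp cY mC.
  have iG := integrableS measurableT mC (@subsetT _ _) (integrable_gauss Hs Hp).
  rewrite -/(Rintegral _ _ _) RintegralZl//.
  have -> : (2 * pi) `^ ((codim S k)%:R / 2) / Num.sqrt (\det (H p)) =
      Num.sqrt ((2 * pi) ^+ codim S k / \det (H p)).
    have pi2 : 0 <= 2 * pi :> R by rewrite mulr_ge0// pi_ge0.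
    rewrite sqrtrM ?exprn_ge0// sqrtrV; last first.
      by have [/ltW] := gauss_cos_integral Hs Hp.
    by rewrite powRrM powR12_sqrt ?powR_ge0// powR_mulrn.
  by rewrite mulVKf// gt_eqF.
- by move=> ->; rewrite preimage_setT probability_setT.
(* The variance of the projection is [qform H (u *m invmx H)], positive because u H^-1 vanishes only
   for u = 0. *)
- move=> u u0 ->; have [_ law] := centered_gaussian_rv cY u.
  apply: gaussian_rv_ge0 law; rewrite sqrtr_gt0 -(qform_invmx Hs Hp) Hp//.
  apply: contra u0 => /eqP uH; apply/eqP.
  by rewrite -(mulmxKV (posdef_unitmx Hs Hp) u) uH mul0mx.
Qed.
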